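(* Let $\alpha\ge 0$, $1\le s\le\infty$, $\mu>1-1/s$, $\mu>0$ (with $1/\infty=0$). (1) For all $0<\delta<1$, $$E_\delta(W^\mu_s,\mathcal M,C)\asymp\mathcal E_\delta(W^\mu_s,\Psi,C,\ell_2)\asymp\delta^{\frac{\mu+1/s-1}{\mu+1/s-1/2}}.$$ (2) For any fixed $0<a\le b$, for all $0<\delta<1$ and all integers $N\ge1$ with $a\,\delta^{-\frac1{\mu+1/s-1/2}}\le N\le b\,\delta^{-\frac1{\mu+1/s-1/2}}$, $$R_{N,\delta}(W^\mu_s,\Psi_N,C,\ell_2)\asymp\delta^{\frac{\mu+1/s-1}{\mu+1/s-1/2}}\asymp N^{-\mu-1/s+1}.$$ (3) These orders are attained by any method from $\mathcal S^\theta$ with $\theta>\mu+1/s-1$, $\theta>0$: for any array $\nu$ in $\mathcal S^\theta$ with constant $C(\nu)$ and any $0<a\le b$ there is a constant $c$ such that, for all $\delta,N$ as in (2), $$\sup_{f\in L_{2,w},\ \|f\|_{s,\mu}\le1}\ \sup_{f^\delta\in L_{2,w}:\ \|f-f^\delta\|_2\le\delta}\|(f-S_N^\nu f^\delta)\sqrt w\|_C\le c\,\delta^{\frac{\mu+1/s-1}{\mu+1/s-1/2}}.$$ All constants depend only on $\alpha,\mu,s$, in (2) also on $a,b$, and in (3) also on $\theta,C(\nu),a,b$.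
   Context: Let $w(t)=t^\alpha e^{-t}$ on $(0,\infty)$, and let $L_{2,w}$ be the real Hilbert space of functions square-summable with weight $w$, with $\langle f,g\rangle=\int_0^\infty t^\alpha e^{-t}f(t)g(t)\,dt$ and norm $\|\cdot\|_2$. The Laguerre polynomials are $L_k^{(\alpha)}(t)=\sum_{m=0}^k\frac{\Gamma(k+\alpha+1)}{\Gamma(m+\alpha+1)(k-m)!}\frac{(-t)^m}{m!}$, and $\ell_k^{(\alpha)}=\left(\frac{k!}{\Gamma(k+\alpha+1)}\right)^{1/2}L_k^{(\alpha)}$, $k\in\mathbb N_0=\{0,1,2,\dots\}$, form an orthonormal basis of $L_{2,w}$. $C$ is the space of real-valued continuous functions on $(0,\infty)$, with $\|g\|_C=\sup_{t>0}|g(t)|\in[0,\infty]$. $\ell_2$ is the usual sequence space on $\mathbb N_0$. For $f\in L_{2,w}$, $\mathbf f=(\langle f,\ell_k^{(\alpha)}\rangle)_{k\in\mathbb N_0}\in\ell_2$. For $\mu>0$ and $\underline k=\max\{1,k\}$: $\|f\|_{s,\mu}^s=\sum_{k=0}^\infty\underline k^{s\mu}|\langle f,\ell_k^{(\alpha)}\rangle|^s$ for $1\le s<\infty$, $\|f\|_{\infty,\mu}=\sup_k\underline k^\mu|\langle f,\ell_k^{(\alpha)}\rangle|$. The function class is $W^\mu_s=\{f\in L_{2,w}:\|f\|_{s,\mu}\le1\}$. For $\mu>1-1/s$ and $f\in W^\mu_s$, $f\sqrt w$ is identified with its continuous representative $\sum_k\langle f,\ell_k^{(\alpha)}\rangle\ell_k^{(\alpha)}\sqrt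 w$ (absolutely and uniformly convergent). $\mathcal M$ is the set of all mappings $m:L_{2,w}\to C$ (no linearity or continuity required), and $$E_\delta(W^\mu_s,\mathcal M,C)=\inf_{m\in\mathcal M}\ \sup_{f\in W^\mu_s}\ \sup_{f^\delta\in L_{2,w},\ \|f-f^\delta\|_2\le\delta}\|(f-m f^\delta)\sqrt w\|_C.$$ Information operators: $G:L_{2,w}\to\ell_2$, $G(f^\delta)=\mathbf f^\delta$; for finite $\Omega\subset\mathbb N_0$, $G_\Omega(f)$ is the sequence whose $k$-th entry is $\langle f,\ell_k^{(\alpha)}\rangle$ if $k\in\Omega$ and $0$ otherwise. A recovery operator is any mapping $\psi:\ell_2\to C$. $\Psi$ is the set of all $\psi G$, and $\Psi_N$ is the set of all $\psi G_\Omega$ with $\operatorname{card}(\Omega)\le N$. For a map $A:L_{2,w}\to C$, $e_\delta(W^\mu_s,A,C,\ell_2)=\sup_{f\in W^\mu_s}\sup_{f^\delta\in L_{2,w}:\|\mathbf f^\delta-\mathbf f\|_{\ell_2}\le\delta}\|(f-A(f^\delta))\sqrt w\|_C$. Set $\mathcal E_\delta(W^\mu_s,\Psi,C,\ell_2)=\inf_{A\in\Psi}e_\delta(W^\mu_s,A,C,\ell_2)$ and $R_{N,\delta}(W^\mu_s,\Psi_N,C,\ell_2)=\inf_{A\in\Psi_N}e_\delta(W^\mu_s,A,C,\ell_2)$. For a triangular array of reals $\nu=\{\nu_k^N\}$, $k=0,\dots,N$, $N\in\mathbb N$, $S_N^\nu f^\delta=\sum_{k=0}^N\nu_k^N\langle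 f^\delta,\ell_k^{(\alpha)}\rangle\ell_k^{(\alpha)}$. For $\theta>0$ the method belongs to $\mathcal S^\theta$ if there is $C(\nu)>0$ with $|1-\nu_k^N|\le C(\nu)(k/N)^\theta$ for all $N\in\mathbb N$, $0\le k\le N$ (with $0^\theta=0$). $A\asymp B$ means each of $A,B$ is bounded by a positive constant times the other. *)

(* Defs.v *)
From HB Require Import structures.
From mathcomp Require Import all_boot all_order all_algebra finmap.
From mathcomp Require Import all_classical all_reals all_analysis measurable_realfun.

Set Implicit Arguments.
Unset Strict Implicit.
Unset Printing Implicit Defensive.

Import Order.TTheory GRing.Theory Num.Theory.
Import numFieldNormedType.Exports.

Local Open Scope classical_set_scope.
Local Open Scope ring_scope.

Section Laguerre.
Context {R : realType}.
Implicit Types (a t : R) (k m : nat).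

Definition Gamma (x : R) : R :=
  \int[lebesgue_measure]_(t in `]0, +oo[) (t `^ (x - 1) * expR (- t)).

Definition weight a t : R := t `^ a * expR (- t).

Definition laguerre a k t : R :=
  \sum_(m < k.+1) Gamma (k%:R + a + 1) / (Gamma (m%:R + a + 1) * (k - m)`!%:R)
    * ((- t) ^+ m / m`!%:R).

Definition ell a k t : R :=
  Num.sqrt (k`!%:R / Gamma (k%:R + a + 1)) * laguerre a k t.

End Laguerre.

(* The measure on R with density [weight a] on (0, +oo), and 0 elsewhere:
   functions on (0, +oo) up to null sets are the same thing as functions on R
   up to null sets of this measure. *)
Section weighted_measure.
Context {R : realType}.
Variable a : R.

Definition wmeasure (A : set (measurableTypeR R)) : \bar R :=
  (\int[lebesgue_measure]_(t in A `&` `]0%R, +oo[) (weight a t)%:E)%E.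

Let wmeasure0 : wmeasure set0 = 0%E.
Proof. by rewrite /wmeasure set0I integral_set0. Qed.

Lemma weight_ge0 t : 0 <= weight a t.
Proof. by rewrite mulr_ge0 ?powR_ge0 ?expR_ge0. Qed.

Lemma measurable_weight (A : set R) : measurable_fun A (weight a).
Proof.
apply: measurable_funTS; apply: measurable_funM.
  exact: measurable_powR.
by apply: measurableT_comp => //; exact: measurableT_comp.
Qed.

Let wmeasure_ge0 A : (0 <= wmeasure A)%E.
Proof. by apply: integral_ge0 => t _; rewrite lee_fin weight_ge0. Qed.

Let wmeasure_sigma_additive : semi_sigma_additive wmeasure.
Proof.
move=> /= F mF tF mUF; rewrite /wmeasure; apply: cvg_toP.
  apply: ereal_nondecreasing_is_cvgn => m n mn.
  apply: lee_sum_nneg_natr => // k _ _; apply: integral_ge0 => /= x _.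
  by rewrite lee_fin weight_ge0.
rewrite setI_bigcupl ge0_integral_bigcup//=.
- by move=> k; exact: measurableI.
- by apply/measurable_EFinP; exact: measurable_weight.
- by move=> x _; rewrite lee_fin weight_ge0.
- exact: trivIset_setIr.
Qed.

HB.instance Definition _ := isMeasure.Build _ _ _
  wmeasure wmeasure0 wmeasure_ge0 wmeasure_sigma_additive.

End weighted_measure.

(* Elements are almost-everywhere classes; the coercion to functions picks a
   representative. *)
Definition L2w {R : realType} (a : R) := LspaceType2 (wmeasure a).

Section recovery.
Context {R : realType}.
Variable a : R.
Implicit Types (f g : L2w a) (s : \bar R) (mu delta : R).

Definition inner (f g : R -> R) : R :=
  \int[lebesgue_measure]_(t in `]0, +oo[) (weight a t * f t * g t).

Definition norm2 (f : R -> R) : R := Num.sqrt (inner f f).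

Definition coef f : R^nat := fun k => inner f (ell a k).

(* Functions on (0, +oo) are represented by functions on R; their values
   outside (0, +oo) are irrelevant in everything that follows. *)
Definition Cpos : set (R -> R) :=
  [set g : R -> R | forall t : R, 0 < t -> {for t, continuous g}].

Definition ell2_norm (x : R^nat) : \bar R :=
  ((\sum_(0 <= k <oo) (x k ^+ 2)%:E) `^ 2^-1)%E.

Definition ell2 : set R^nat := [set x | (ell2_norm x < +oo)%E].

Definition smooth_norm s mu f : \bar R :=
  if s is r%:E then
    ((\sum_(0 <= k <oo)
       ((maxn 1 k)%:R `^ (r * mu) * `|coef f k| `^ r)%:E) `^ r^-1)%E
  else ereal_sup (range (fun k => ((maxn 1 k)%:R `^ mu * `|coef f k|)%:E)).

Definition W s mu : set (L2w a) := [set f | (smooth_norm s mu f <= 1)%E].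

(* The continuous representative of f * sqrt w, for f in W s mu. *)
Definition wrep f (t : R) : R :=
  limn (series (fun k => coef f k * ell a k t * Num.sqrt (weight a t))).

(* || (f - g) sqrt w ||_C *)
Definition errC f (g : R -> R) : \bar R :=
  ereal_sup [set `|wrep f t - g t * Num.sqrt (weight a t)|%:E
            | t in `]0, +oo[].

Definition err_func s mu delta (A : L2w a -> R -> R) : \bar R :=
  ereal_sup [set ereal_sup [set errC f (A fd)
                           | fd in [set fd : L2w a
                                   | norm2 ((f : R -> R) \- (fd : R -> R))
                                     <= delta]]
            | f in W s mu].

Definition err_coef s mu delta (A : L2w a -> R -> R) : \bar R :=
  ereal_sup [set ereal_sup [set errC f (A fd)
                           | fd in [set fd : L2w a
                                   | (ell2_norm (coef fd \- coef f)%R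
                                      <= delta%:E)%E]]
            | f in W s mu].

Definition all_maps : set (L2w a -> R -> R) := set_fun setT Cpos.

(* A map from ell2 to Cpos is a function on all sequences, of which only the
   values on ell2 matter ([coef f] is in ell2 by Bessel's inequality). *)
Definition Psi : set (L2w a -> R -> R) :=
  [set psi \o coef | psi in set_fun ell2 Cpos].

Definition coef_on (Omega : {fset nat}) f : R^nat :=
  fun k => if k \in Omega then coef f k else 0.

Definition PsiN (N : nat) : set (L2w a -> R -> R) :=
  [set A | exists2 Omega : {fset nat}, (#|` Omega| <= N)%N &
           exists2 psi : R^nat -> R -> R, set_fun ell2 Cpos psi &
           A = psi \o coef_on Omega].

Definition E_opt s mu delta : \bar R :=
  ereal_inf [set err_func s mu delta A | A in all_maps].

Definition E_Psi s mu delta : \bar R :=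
  ereal_inf [set err_coef s mu delta A | A in Psi].

Definition R_opt s mu (N : nat) delta : \bar R :=
  ereal_inf [set err_coef s mu delta A | A in PsiN N].

Definition summation (nu : nat -> nat -> R) (N : nat) f (t : R) : R :=
  \sum_(k < N.+1) nu N k * coef f k * ell a k t.

End recovery.

(* [nu N k] is the entry of the array with upper index N and lower index k. *)
Definition in_S {R : realType} (theta Cnu : R) (nu : nat -> nat -> R) : Prop :=
  forall N k : nat, (1 <= N)%N -> (k <= N)%N ->
    `|1 - nu N k| <= Cnu * (k%:R / N%:R) `^ theta.

(* A and B bound each other up to the constant factor c. *)
Definition asymp {R : realType} (c : R) (A B : \bar R) : Prop :=
  (A <= c%:E * B)%E /\ (B <= c%:E * A)%E.

(* 1 / s, with 1 / +oo = 0. *)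
Definition sinv {R : realType} (s : \bar R) : R := fine (s^-1)%E.

Definition rate {R : realType} (s : \bar R) (mu delta : R) : R :=
  delta `^ ((mu + sinv s - 1) / (mu + sinv s - 2^-1)).

Definition Nopt {R : realType} (s : \bar R) (mu delta : R) : R :=
  delta `^ (- (1 / (mu + sinv s - 2^-1))).

(* Main.v *)
(** Everything rests on a bound [|ell_k(t) sqrt(w(t))| <= C] uniform in [k] and
    [t].  With [kappa = k + (alpha + 1) / 2], it comes from the power series for
    [t <= (alpha^2 + 1) / kappa], from a decreasing function of Sonin type for
    larger [t <= 2 kappa], and beyond [2 kappa] from integrating the derivative
    of [w L_k^2] up to a point where [w L_k^2 <= int w L_k^2], the integral being
    controlled by the exact values of [int w L_k^2] and [int w t L_k'^2].

    Put [sigma = mu + 1/s - 1] and [X = delta^(-1 / (sigma + 1/2))].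
    Upper bound: the coefficients of [f] in the class satisfy
    [|f_k| <= k^(-sigma-1) + k^(-sigma) e_k] with [sum e_k <= 1], so truncation at
    [N ~ X] and damping both cost [O(X^(-sigma))], while by Cauchy-Schwarz the
    noise costs [O(delta sqrt N)], which has the same order.  Lower bound: the
    functions [f] and [-f], where [f] has equal coefficients on [M <= k < 2M] with
    [M ~ X], lie in the class and are [delta]-close to 0, yet near [t ~ 1/M] all
    the [ell_k sqrt(w)] with [k < 2M] are bounded below, so
    [f(t) sqrt(w(t)) >= c X^(-sigma)]. *)

From HB Require Import structures.
Require Import Defs.
From mathcomp Require Import all_boot all_order all_algebra finmap.
From mathcomp Require Import all_classical all_reals all_analysis.
From mathcomp Require Import ring lra measurable_realfun.
Set Implicit Arguments.
Unset Strict Implicit.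
Unset Printing Implicit Defensive.
Import Order.TTheory GRing.Theory Num.Theory.
Import numFieldNormedType.Exports.
Local Open Scope classical_set_scope.
Local Open Scope ring_scope.

(** * The weighted measure and its moments *)

(** The two bounds match because the uniform bound on the weighted basis functions is attained, up
    to a constant, at one point by a whole block. Near t = 1/(6M) the polynomials of degree below 2M
    still have the sign and the order of magnitude of their values at 0, so their contributions add
    without cancellation, and the triangle inequality and Cauchy-Schwarz used for the upper bound
    lose only constants.

    The splitting of the coefficients treats all s at once. A coefficient is compared with the
    critical size k^(-(mu + 1/s)): one below it is bounded pointwise, one above it is charged
    linearly to the summable s-th powers. Every later estimate involves only sigma.

    The facts about orthogonality and norms are polynomial algebra: integration against the weight
    is replaced by a linear functional on polynomials with values of Gamma on monomials. Analysis
    enters only where pointwise values are compared with integrals. *)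

Section wmeasure_integral.
Context {R : realType}.
Variable a : R.
Local Notation mu := (@lebesgue_measure R).
Local Notation wm := (wmeasure a).
Local Open Scope ereal_scope.

Let integral_wmeasure_indic E : measurable E ->
  \int[wm]_x (\1_E x)%:E =
  \int[mu]_(x in `]0%R, +oo[) ((weight a x)%:E * (\1_E x)%:E).
Proof.
move=> mE; rewrite integral_indic// setIT.
rewrite -[LHS]/(\int[mu]_(x in E `&` `]0%R, +oo[) (weight a x)%:E).
rewrite integral_mkcondl.
by apply: eq_integral => x _; rewrite epatch_indic.
Qed.

Import HBNNSimple.

Let measurable_weightE (A : set R) :
  measurable_fun A (fun x => (weight a x)%:E).
Proof. by apply/measurable_EFinP; exact: measurable_weight. Qed.

Let integral_wmeasure_nnsfun (h : {nnsfun measurableTypeR R >-> R}) :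
  \int[wm]_x (h x)%:E =
  \int[mu]_(x in `]0%R, +oo[) ((weight a x)%:E * (h x)%:E).
Proof.
under [LHS]eq_integral do rewrite fimfunE -fsumEFin//.
rewrite [LHS]ge0_integral_fsum//; last 2 first.
  - by move=> r; exact/measurable_EFinP/measurableT_comp.
  - by move=> n x _; rewrite EFinM nnfun_muleindic_ge0.
under [RHS]eq_integral.
  move=> x xD; rewrite fimfunE -fsumEFin// ge0_mule_fsumr; last first.
    by move=> r; rewrite EFinM nnfun_muleindic_ge0.
  over.
rewrite [RHS]ge0_integral_fsum//; last 2 first.
  - move=> r; apply: emeasurable_funM; first exact: measurable_weightE.
    apply: measurable_funTS.
    exact/measurable_EFinP/measurableT_comp.
  - move=> n x _; apply: mule_ge0; first by rewrite lee_fin weight_ge0.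
    by rewrite EFinM nnfun_muleindic_ge0.
apply: eq_fsbigr => r _; rewrite integralZl_indic_nnsfun//=.
rewrite integral_wmeasure_indic//.
(* A negative value is never taken by a nonnegative simple function: its preimage is empty and both
   sides vanish. *)
have [r0|r0] := leP 0%R r.
  rewrite -ge0_integralZl//.
  - by apply: eq_integral => x _; rewrite EFinM muleCA.
  - apply: emeasurable_funM; first exact: measurable_weightE.
    by apply/measurable_EFinP/measurable_funTS.
  - by move=> x _; rewrite mule_ge0// ?lee_fin ?weight_ge0.
rewrite preimage_nnfun0//.
under eq_integral do rewrite indic0 mule0.
under [RHS]eq_integral do rewrite indic0 mulr0 mule0.
by rewrite !integral0 mule0.
Qed.

(** Indicators hold by the definition of [wmeasure], simple functions by linearity, and the general
    case by monotone convergence on both sides. *)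
Lemma ge0_integral_wmeasure (f : measurableTypeR R -> \bar R) :
  measurable_fun setT f -> (forall x, 0 <= f x) ->
  \int[wm]_x f x = \int[mu]_(x in `]0%R, +oo[) ((weight a x)%:E * f x).
Proof.
move=> mf f0; pose f_ := nnsfun_approx measurableT mf.
have w0 x : 0 <= (weight a x)%:E by rewrite lee_fin weight_ge0.
transitivity (limn (fun n => \int[wm]_x (f_ n x)%:E)).
  rewrite -monotone_convergence//=.
  - apply: eq_integral => x /[!inE] xD; apply/esym/cvg_lim => //=.
    exact: cvg_nnsfun_approx.
  - by move=> n; apply/measurable_EFinP.
  - by move=> n x _; rewrite lee_fin.
  - by move=> x _ m n mn; rewrite lee_fin//; exact/lefP/nd_nnsfun_approx.
rewrite [RHS](_ : _ = limn (fun n =>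
    \int[mu]_(x in `]0%R, +oo[) ((weight a x)%:E * (f_ n x)%:E))).
  congr (limn _); apply/funext => n.
  exact: integral_wmeasure_nnsfun.
rewrite -monotone_convergence//=.
- apply: eq_integral => x /[!inE] xD; apply/esym/cvg_lim => //=.
  apply: cvgeMl => //.
  exact: cvg_nnsfun_approx.
- move=> n; apply: emeasurable_funM; first exact: measurable_weightE.
  exact/measurable_EFinP/measurable_funTS.
- by move=> n x _; rewrite mule_ge0// lee_fin.
- move=> x _ m n mn; rewrite lee_pmul// lee_fin//.
  exact/lefP/nd_nnsfun_approx.
Qed.

End wmeasure_integral.

(** * The weight and the Gamma function *)

Section Gamma_function.
Context {R : realType}.
Implicit Types a t : R.
Local Notation mu := (@lebesgue_measure R).

(** The inequality t/c <= exp(t/c) is raised to the power a, with c = 2(a + 1) chosen so that a/c <=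
    1/2. Half of the decay of exp(-t) then survives in [weight], which yields both integrability and
    the limit at infinity. *)
Lemma powR_le_expR a t : 0 <= a -> 0 <= t ->
  t `^ a <= (2 * (a + 1)) `^ a * expR (t / 2).
Proof.
move=> a0 t0; set c := 2 * (a + 1).
have c0 : 0 < c by rewrite mulr_gt0// ltr_wpDl.
have tc : t <= c * expR (t / c).
  rewrite mulrC -ler_pdivrMr// (le_trans _ (expR_ge1Dx _))//.
  by rewrite lerDr.
apply: (@le_trans _ _ ((c * expR (t / c)) `^ a)).
  by rewrite ge0_ler_powR// nnegrE// mulr_ge0 ?expR_ge0 ?ltW.
rewrite powRM ?expR_ge0 ?(ltW c0)// -expRM ler_wpM2l ?powR_ge0// ler_expR.
have -> : t / c * a = t / 2 * (a / (a + 1)).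
  by rewrite /c; field; rewrite gt_eqF// ltr_wpDl.
rewrite ler_piMr ?divr_ge0// ler_pdivrMr ?ltr_wpDl//.
by rewrite mul1r lerDl.
Qed.

Lemma weight_cvg0y a : 0 <= a -> weight a t @[t --> +oo] --> (0 : R).
Proof.
move=> a0.
have e2 : (2 * (a + 1)) `^ a * expR (- (2^-1 * t)) @[t --> +oo%R] --> (0 : R).
  rewrite -[X in _ --> X](mulr0 ((2 * (a + 1)) `^ a)).
  apply: cvgMr.
  rewrite (_ : (fun t : R => _) =
               (fun z => expR (- z)) \o (fun z => 2^-1 * z)) //.
  apply: (@cvg_comp _ _ _ _ _ _ (pinfty_nbhs R)); last exact: cvgr_expR.
  exact: gt0_cvgMry.
apply: (@squeeze_cvgr _ _ _ _ (fun=> 0) _ _ _ _ _ e2); last exact: cvg_cst.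
near=> t.
have t0 : 0 <= t by near: t; exact: nbhs_pinfty_ge.
rewrite weight_ge0/= /weight.
rewrite (le_trans (ler_wpM2r (expR_ge0 _) (powR_le_expR a0 t0)))//.
rewrite -mulrA -expRD ler_wpM2l ?powR_ge0// ler_expR.
lra.
Unshelve. all: by end_near. Qed.

Lemma is_derive_weight a t : 0 < t ->
  is_derive t 1 (weight a) (a * weight (a - 1) t - weight a t).
Proof.
move=> t0; rewrite /weight.
have := is_derive1_powR a t0 => h1.
have h2 : is_derive t 1 (fun x : R => expR (- x)) (- expR (- t)).
  apply: (trigger_derive (is_derive1_comp _ _)).
  by rewrite mulrN1.
apply: trigger_derive (is_deriveM h1 h2) _.
rewrite /GRing.scale/=; ring.
Qed.

Lemma weight_continuous a t : 0 < t -> {for t, continuous (weight a)}.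
Proof.
move=> t0; apply: differentiable_continuous; apply/derivable1_diffP.
exact: (@ex_derive _ _ _ _ _ _ _ (is_derive_weight a t0)).
Qed.

Lemma weight_cvg_at_right0 a : 0 <= a -> weight a t @[t --> 0^'+] --> weight a 0.
Proof.
(* The case a = 0 stands apart: the power 0^0 is 1, so the weight starts at 1 instead of 0. *)
rewrite le_eqVlt => /predU1P[<-|a0].
  rewrite (_ : weight 0 = fun t => expR (- t)); last first.
    by apply/funext => t; rewrite /weight powRr0 mul1r.
  apply: cvg_at_right_filter.
  apply: continuous_comp; last exact: continuous_expR.
  exact: opp_continuous.
rewrite /weight powR0 ?gt_eqF//; apply: cvgM; first exact: powR_cvg0.
apply: cvg_at_right_filter.
apply: continuous_comp; last exact: continuous_expR.
exact: opp_continuous.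
Qed.

Lemma weight_within_continuous a : 0 <= a ->
  {within `[0, +oo[, continuous (weight a)}.
Proof.
move=> a0; apply/continuous_within_itvcyP; split.
  by move=> t; rewrite in_itv/= andbT; exact: weight_continuous.
exact: weight_cvg_at_right0.
Qed.

Local Lemma measurable_EFin_weight a (A : set R) :
  measurable_fun A (fun t => (weight a t)%:E).
Proof. by apply/measurable_EFinP; exact: measurable_weight. Qed.

Lemma integral_expR_half :
  (\int[mu]_(t in `[0%R, +oo[) (2^-1 * expR (- (2^-1 * t)))%:E = 1)%E.
Proof.
have ce (t : R) : {for t, continuous (fun t => expR (- (2^-1 * t)))}.
  apply: continuous_comp; last exact: continuous_expR.
  apply: continuousN; apply: continuousM => //; exact: cst_continuous.
rewrite (@ge0_continuous_FTC2y _ _ (fun t => - expR (- (2^-1 * t))) _ 0)//.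
- by rewrite mulr0 oppr0 expR0 EFinN oppeK add0e.
- apply: continuous_subspaceT => t.
  by apply: cvgM; [exact: cvg_cst|exact: ce].
- rewrite -[X in _ --> X]oppr0; apply: cvgN.
  rewrite (_ : (fun t : R => _) =
               (fun z => expR (- z)) \o (fun z => 2^-1 * z)) //.
  apply: (@cvg_comp _ _ _ _ _ _ (pinfty_nbhs R)); last exact: cvgr_expR.
  exact: gt0_cvgMry.
- by apply: cvgN; apply: cvg_at_right_filter; exact: ce.
- move=> t t0; rewrite derive1E derive_val.
  by rewrite /GRing.scale/=; ring.
Qed.

Lemma integral_weight_lty a : 0 <= a ->
  (\int[mu]_(t in `]0%R, +oo[) (weight a t)%:E < +oo)%E.
Proof.
move=> a0; set K := (2 * (a + 1)) `^ a.
apply: (@le_lt_trans _ _ (\int[mu]_(t in `[0%R, +oo[)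
   ((2 * K)%:E * (2^-1 * expR (- (2^-1 * t)))%:E))%E).
  rewrite integral_itv_obnd_cbnd; last exact: measurable_EFin_weight.
  apply: ge0_le_integral => //.
  - by move=> t _; rewrite lee_fin weight_ge0.
  - exact: measurable_EFin_weight.
  - apply/measurable_EFinP; apply: measurable_funM => //.
    apply: measurable_funM => //; apply: measurableT_comp => //.
    by apply: measurableT_comp => //; exact: measurable_funM.
  - move=> t; rewrite /= in_itv/= andbT => t0.
    rewrite -EFinM lee_fin /weight.
    rewrite (le_trans (ler_wpM2r (expR_ge0 _) (powR_le_expR a0 t0)))// -/K.
    rewrite -mulrA -expRD.
    rewrite (_ : t / 2 - t = - (2^-1 * t)); last by lra.
    by rewrite mulrACA divff// mul1r.
rewrite ge0_integralZl//=.
- by rewrite integral_expR_half mule1 ltry.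
- apply/measurable_EFinP.
  apply: measurable_funM => //; apply: measurableT_comp => //.
  by apply: measurableT_comp => //; exact: measurable_funM.
- by rewrite lee_fin mulr_ge0 ?powR_ge0.
Qed.

Lemma integral_weight a : 0 <= a ->
  (\int[mu]_(t in `]0%R, +oo[) (weight a t)%:E = (Gamma (a + 1))%:E)%E.
Proof.
move=> a0; rewrite /Gamma addrK /Rintegral fineK// ge0_fin_numE.
  exact: integral_weight_lty.
by apply: integral_ge0 => t _; rewrite lee_fin weight_ge0.
Qed.

(** On [1, 2] the weight is at least exp(-2), since t^a >= 1 there. *)
Lemma Gamma_gt0 a : 0 <= a -> 0 < Gamma (a + 1).
Proof.
move=> a0; rewrite -lte_fin -integral_weight//.
apply: (@lt_le_trans _ _ (\int[mu]_(t in `[1%R, 2%R]) (expR (- 2))%:E)%E).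
  rewrite integral_cst//= lebesgue_measure_itv/= lte_fin ltr1n -EFinB -EFinM.
  by rewrite lte_fin (_ : 2 - 1 = 1) ?mulr1 ?expR_gt0//; lra.
apply: (@le_trans _ _ (\int[mu]_(t in `[1%R, 2%R]) (weight a t)%:E)%E).
  apply: ge0_le_integral => //.
  - exact: measurable_EFin_weight.
  - move=> t; rewrite /= in_itv/= => /andP[t1 t2].
    rewrite lee_fin /weight -[leLHS]mul1r ler_pM//.
      by rewrite -[leLHS](powRr0 t) ler_powR.
    by rewrite ler_expR lerN2.
apply: ge0_subset_integral => //.
- exact: measurable_EFin_weight.
- by move=> t _; rewrite lee_fin weight_ge0.
- by move=> t; rewrite /= !in_itv/= andbT => /andP[t1 _]; rewrite (lt_le_trans ltr01).
Qed.

(* The extra term [K * expR (- t / 2)] makes the integrand nonnegative, so that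
   the fundamental theorem applies on the unbounded interval. *)
Lemma GammaS a : 0 <= a -> Gamma (a + 1 + 1) = (a + 1) * Gamma (a + 1).
Proof.
move=> a0; have a10 : 0 <= a + 1 by rewrite ltW// ltr_wpDl.
pose K : R := 2 * ((a + 1) * (2 * (a + 1)) `^ a).
have K0 : 0 <= K by rewrite !mulr_ge0 ?powR_ge0// mulr_ge0.
pose e (t : R) := 2^-1 * expR (- (2^-1 * t)).
have ce (t : R) : {for t, continuous (fun t => expR (- (2^-1 * t)))}.
  apply: continuous_comp; last exact: continuous_expR.
  apply: continuousN; apply: continuousM => //; exact: cst_continuous.
pose f t := weight (a + 1) t + K * e t - (a + 1) * weight a t.
have Ke_ge0 t : 0 <= t -> 0 <= K * e t - (a + 1) * weight a t.
  move=> t0; rewrite subr_ge0 /weight.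
  rewrite (le_trans (ler_wpM2l a10 (ler_wpM2r (expR_ge0 _) (powR_le_expR a0 t0))))//.
  rewrite /K /e -[X in _ * X <= _]mulrA -expRD (_ : t / 2 - t = - (2^-1 * t)); last by lra.
  by rewrite mulrACA divff// mul1r mulrA.
have me : measurable_fun setT e.
  apply: measurable_funM => //; apply: measurableT_comp => //.
  by apply: measurableT_comp => //; exact: measurable_funM.
have : (\int[mu]_(t in `[0%R, +oo[) (f t)%:E = K%:E)%E.
  rewrite (@ge0_continuous_FTC2y _ _
     (fun t => - weight (a + 1) t - K * expR (- (2^-1 * t))) _ 0)//.
  - rewrite mulr0 oppr0 expR0 mulr1 /weight powR0 ?mul0r ?oppr0 ?sub0r.
      by rewrite EFinN oppeK add0e.
    by rewrite gt_eqF// ltr_wpDl.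
  - by move=> t t0; rewrite /f -addrA addr_ge0 ?weight_ge0// Ke_ge0.
  - move=> t; apply: cvgB; first apply: cvgD.
    + exact: (weight_within_continuous a10).
    + apply: (@continuous_subspaceT _ _ _ (fun t => K * e t)) => {}t.
      apply: cvgM; first exact: cvg_cst.
      by apply: cvgM; [exact: cvg_cst|exact: ce].
    + apply: cvgM; first exact: cvg_cst.
      exact: (weight_within_continuous a0).
  - rewrite -[X in _ --> X](subr0 (0 : R)) -{1}oppr0; apply: cvgB.
      by apply: cvgN; exact: weight_cvg0y.
    rewrite -[X in _ --> X](mulr0 K); apply: cvgM; first exact: cvg_cst.
    rewrite (_ : (fun t : R => _) =
               (fun z => expR (- z)) \o (fun z => 2^-1 * z)) //.
    apply: (@cvg_comp _ _ _ _ _ _ (pinfty_nbhs R)); last exact: cvgr_expR.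
    exact: gt0_cvgMry.
  - move=> t t0; have := is_derive_weight (a + 1) t0 => ?.
    exact: ex_derive.
  - apply: cvgB; first by apply: cvgN; exact: weight_cvg_at_right0.
    apply: cvgM; first exact: cvg_cst.
    by apply: cvg_at_right_filter; exact: ce.
  - move=> t; rewrite in_itv/= andbT => t0; rewrite derive1E.
    have := is_derive_weight (a + 1) t0 => dw.
    rewrite derive_val /f /e addrK /GRing.scale/=; ring.
rewrite -integral_itv_obnd_cbnd; last first.
  apply/measurable_EFinP; apply: measurable_funB; first apply: measurable_funD.
  - exact: measurable_weight.
  - by apply: measurable_funTS; exact: measurable_funM.
  - by apply: measurable_funM => //; exact: measurable_weight.
have intw b : 0 <= b -> mu.-integrable `]0%R, +oo[ (EFin \o weight b).
  move=> b0; apply/integrableP; split; first exact: measurable_EFin_weight.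
  under eq_integral do rewrite /= ger0_norm ?weight_ge0//.
  exact: integral_weight_lty.
have inte : mu.-integrable `]0%R, +oo[ (EFin \o e).
  apply/integrableP; split; first by apply/measurable_EFinP; exact: measurable_funTS.
  under eq_integral do rewrite /= ger0_norm ?mulr_ge0 ?expR_ge0//.
  rewrite integral_itv_obnd_cbnd; last first.
    by apply/measurable_EFinP; exact: measurable_funTS.
  by rewrite integral_expR_half ltry.
have inteE : (\int[mu]_(t in `]0%R, +oo[) (e t)%:E = 1)%E.
  rewrite integral_itv_obnd_cbnd ?integral_expR_half//.
  by apply/measurable_EFinP; exact: measurable_funTS.
have fE t : (f t)%:E = ((weight (a + 1) t)%:E + K%:E * (e t)%:E
    - (a + 1)%:E * (weight a t)%:E)%E by [].
under eq_integral do rewrite fE.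
rewrite integralB//=; last 2 first.
  - apply: integrableD => //; first exact: intw.
    exact: (@integrableZl _ _ _ mu _ _ K).
  - exact: (@integrableZl _ _ _ mu _ _ (a + 1) _ (intw _ a0)).
rewrite integralD//=; last 2 first.
  - exact: intw.
  - exact: (@integrableZl _ _ _ mu _ _ K).
rewrite !integralZl//=; last exact: intw.
by rewrite inteE !integral_weight// mule1 => -[] h; lra.
Qed.

End Gamma_function.

Section wmeasure_Rintegral.
Context {R : realType}.
Variable a : R.
Local Notation mu := (@lebesgue_measure R).
Local Notation wm := (wmeasure a).
Local Open Scope ereal_scope.

Lemma integral_wmeasure (f : measurableTypeR R -> \bar R) :
  measurable_fun setT f ->
  \int[wm]_x f x = \int[mu]_(x in `]0%R, +oo[) ((weight a x)%:E * f x).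
Proof.
move=> mf; rewrite integralE [RHS]integralE.
rewrite ge0_integral_wmeasure//; last exact: measurable_funepos.
rewrite ge0_integral_wmeasure//; last exact: measurable_funeneg.
have w0 x : 0 <= (weight a x)%:E by rewrite lee_fin weight_ge0.
congr (_ - _); apply: eq_integral => x _.
- by rewrite !funeposE maxe_pMr// mule0.
- by rewrite !funenegE -muleN maxe_pMr// mule0.
Qed.

Lemma integrable_wmeasure (f : measurableTypeR R -> R) :
  measurable_fun setT f ->
  wm.-integrable setT (EFin \o f) <->
  mu.-integrable `]0%R, +oo[ (fun x => (weight a x * f x)%:E).
Proof.
move=> mf.
have mwf : measurable_fun (`]0%R, +oo[%classic : set (measurableTypeR R))
    (fun x => (weight a x * f x)%:E).
  apply/measurable_EFinP; apply: measurable_funM; first exact: measurable_weight.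
  exact: measurable_funTS.
have E : \int[wm]_x `|(f x)%:E| =
         \int[mu]_(x in `]0%R, +oo[) `|(weight a x * f x)%:E|.
  rewrite ge0_integral_wmeasure//; last first.
    by apply: measurableT_comp => //; exact/measurable_EFinP.
  by apply: eq_integral => x _; rewrite /= normrM ger0_norm ?weight_ge0.
split=> /integrableP[_ h]; apply/integrableP; split => //.
- by rewrite -E.
- exact/measurable_EFinP.
- by rewrite E.
Qed.

End wmeasure_Rintegral.

(** * Moments of polynomials as an algebraic functional *)

Section moments.
Context {R : realType}.
Implicit Types (a : R) (p q : {poly R}) (m n : nat).
Local Notation mu := (@lebesgue_measure R).

Lemma weightDn a n (t : R) : 0 < t -> weight (a + n%:R) t = weight a t * t ^+ n.
Proof.
move=> t0; rewrite /weight powRD; last by rewrite (gt_eqF t0) implybT.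
by rewrite powR_mulrn ?ltW// mulrAC.
Qed.

Lemma GammaS_natr a n : 0 <= a ->
  Gamma (n.+1%:R + a + 1) = (n%:R + a + 1) * Gamma (n%:R + a + 1).
Proof.
move=> a0; have -> : n.+1%:R + a = n%:R + a + 1 by rewrite -natr1 addrAC.
by rewrite GammaS// addr_ge0.
Qed.

Lemma Gamma_natr_gt0 a n : 0 <= a -> 0 < Gamma (n%:R + a + 1).
Proof. by move=> a0; rewrite Gamma_gt0// addr_ge0. Qed.

(** This is the integral of p against the weight, encoded algebraically so that integration by
    parts, orthogonality and norms become identities between coefficients. [Rintegral_poly] makes
    the link with the integral. *)
Definition moment a p : R := \sum_(i < size p) p`_i * Gamma (i%:R + a + 1).

Lemma momentE a p n : (size p <= n)%N ->
  moment a p = \sum_(i < n) p`_i * Gamma (i%:R + a + 1).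
Proof.
move=> pn; rewrite /moment (big_ord_widen _ (fun i => p`_i * Gamma (i%:R + a + 1)) pn).
rewrite big_mkcond; apply: eq_bigr => i _; case: ltnP => // pi.
by rewrite nth_default// mul0r.
Qed.

Lemma moment_is_linear a : linear (moment a).
Proof.
move=> c p q; pose n := maxn (size p) (size q).
rewrite (@momentE a p n) ?leq_maxl// (@momentE a q n) ?leq_maxr//.
rewrite (@momentE a _ n); last first.
  rewrite (leq_trans (size_polyD _ _))// geq_max leq_maxr andbT.
  by rewrite (leq_trans (size_scale_leq _ _))// leq_maxl.
rewrite scaler_sumr -big_split/=; apply: eq_bigr => i _.
by rewrite coefD coefZ mulrDl -mulrA.
Qed.

HB.instance Definition _ a :=
  GRing.isLinear.Build R {poly R} R _ (moment a) (moment_is_linear a).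

Lemma momentXn a n : moment a 'X^n = Gamma (n%:R + a + 1).
Proof.
rewrite /moment size_polyXn big_ord_recr/= big1 ?add0r; last first.
  by move=> i _; rewrite coefXn ltn_eqF ?mul0r.
by rewrite coefXn eqxx mul1r.
Qed.

Lemma poly_monomial_ind (P : {poly R} -> Prop) :
  (forall c n, P (c *: 'X^n)) -> (forall p q, P p -> P q -> P (p + q)) ->
  forall p, P p.
Proof.
move=> PX PD p; rewrite -(coefK p) poly_def.
apply: (big_ind P) => //; first by rewrite -(scale0r 'X^0).
Qed.

(** A factor t passes into the weight. Since differentiating a Laguerre polynomial also raises the
    parameter by one, this supports inductions that let a vary. *)
Lemma momentMX a p : moment a ('X * p) = moment (a + 1) p.
Proof.
elim/poly_monomial_ind: p => [c n|p q ip iq].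
  rewrite -scalerAr -exprS !linearZ/= !momentXn.
  by congr (_ * Gamma _); rewrite -natr1; ring.
by rewrite mulrDr !raddfD/= ip iq.
Qed.

(** Integration by parts based on (t w)' = (a + 1 - t) w. On monomials it is the functional equation
    of Gamma, so no boundary term has to be examined. *)
Lemma moment_by_parts a p : 0 <= a ->
  moment a ('X * p^`()) = moment a ('X * p) - (a + 1) * moment a p.
Proof.
move=> a0; elim/poly_monomial_ind: p => [c n|p q ip iq]; last first.
  by rewrite derivD !mulrDr !raddfD/= ip iq; ring.
rewrite derivZ derivXn -!scalerAr mulrnAr -!exprS !linearZ/= raddfMn/=.
case: n => [|n].
  rewrite mulr0n !momentXn GammaS_natr// /GRing.scale/=; ring.
rewrite /= !momentXn (GammaS_natr n.+1)// /GRing.scale/= -mulr_natr -(natr1 n); ring.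
Qed.

Let integrable_monomial a n : 0 <= a ->
  (wmeasure a).-integrable setT (EFin \o (fun t : measurableTypeR R => t ^+ n)).
Proof.
move=> a0; apply/integrable_wmeasure; first exact: exprn_measurable.
have mw : measurable_fun (`]0, +oo[%classic : set (measurableTypeR R))
    (fun t => (weight a t * t ^+ n)%:E).
  apply/measurable_EFinP; apply: measurable_funM; first exact: measurable_weight.
  by apply: measurable_funTS; exact: exprn_measurable.
apply/integrableP; split => //.
have an0 : 0 <= a + n%:R by rewrite addr_ge0.
apply: le_lt_trans (integral_weight_lty an0).
rewrite le_eqVlt; apply/orP; left; apply/eqP; apply: eq_integral => t.
rewrite inE/= in_itv/= andbT => t0.
rewrite ger0_norm; last exact: mulr_ge0 (weight_ge0 _ _) (exprn_ge0 _ (ltW t0)).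
by rewrite weightDn.
Qed.

Let Rintegral_monomial a n : 0 <= a ->
  \int[wmeasure a]_t (t ^+ n) = moment a 'X^n.
Proof.
move=> a0; rewrite momentXn /Rintegral integral_wmeasure; last first.
  by apply/measurable_EFinP; exact: exprn_measurable.
have an0 : 0 <= n%:R + a by rewrite addr_ge0.
have : (\int[mu]_(x in `]0%R, +oo[) ((weight a x)%:E * (x ^+ n)%:E))%E =
  (Gamma (n%:R + a + 1))%:E.
  rewrite -integral_weight//; apply: eq_integral => t.
  rewrite inE/= in_itv/= andbT => t0.
  by rewrite -EFinM addrC weightDn.
by move=> ->.
Qed.

(** Both claims go through one induction, because additivity of the integral requires the
    integrability of each summand. *)
Let poly_moment a p : 0 <= a ->
  (wmeasure a).-integrable setT (EFin \o horner p) /\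
  \int[wmeasure a]_t p.[t] = moment a p.
Proof.
move=> a0; elim/poly_monomial_ind: p => [c n|q1 q2 [i1 e1] [i2 e2]].
- split.
    rewrite (_ : _ \o _ = (fun t => c%:E * (EFin \o (fun t : measurableTypeR R => t ^+ n)%R) t)%E).
      by apply: integrableZl => //; exact: integrable_monomial.
    by apply/funext => t/=; rewrite hornerZ hornerXn.
  rewrite linearZ/= -Rintegral_monomial// /GRing.scale/= -RintegralZl//; last first.
    exact: integrable_monomial.
  by apply: eq_Rintegral => t _; rewrite hornerZ hornerXn.
- split.
    rewrite (_ : _ \o _ = ((EFin \o horner q1) \+ (EFin \o horner q2))%E).
      exact: integrableD.
    by apply/funext => t/=; rewrite hornerD.
  rewrite raddfD/= -e1 -e2 -RintegralD//.
  by apply: eq_Rintegral => t _; rewrite hornerD.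
Qed.

Lemma integrable_poly a p : 0 <= a ->
  (wmeasure a).-integrable setT (EFin \o horner p).
Proof. by move=> a0; have [] := poly_moment p a0. Qed.

Lemma Rintegral_poly a p : 0 <= a -> \int[wmeasure a]_t p.[t] = moment a p.
Proof. by move=> a0; have [] := poly_moment p a0. Qed.

End moments.

(** * Uniform bound on the weighted Laguerre polynomials *)

Section laguerre_polynomials.
Context {R : realType}.
Implicit Types (a t : R) (p q : {poly R}) (m n k : nat).

Definition lag a n : {poly R} :=
  \poly_(m < n.+1) (Gamma (n%:R + a + 1) / (Gamma (m%:R + a + 1) * (n - m)`!%:R)
    * ((-1) ^+ m / m`!%:R)).

(** The squared norm of the n-th Laguerre polynomial ([moment_lag_lag]), and also its value at 0
    times Gamma(a + 1) ([coef0_lag]). *)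
Definition lag_norm a n : R := Gamma (n%:R + a + 1) / n`!%:R.

Lemma horner_lag a n t : (lag a n).[t] = laguerre a n t.
Proof.
rewrite horner_poly; apply: eq_bigr => m _.
by rewrite -[- t]mulN1r exprMn; ring.
Qed.

Lemma lag_norm_gt0 a n : 0 <= a -> 0 < lag_norm a n.
Proof. by move=> a0; rewrite divr_gt0// ?Gamma_natr_gt0// ltr0n fact_gt0. Qed.

Lemma lag_normS a n : 0 <= a ->
  lag_norm a n.+1 = lag_norm a n * ((n%:R + a + 1) / n.+1%:R).
Proof.
move=> a0; rewrite /lag_norm GammaS_natr// factS natrM.
have h1 : n.+1%:R != 0 :> R by rewrite pnatr_eq0.
have h2 : n`!%:R != 0 :> R by rewrite pnatr_eq0 -lt0n fact_gt0.
by move: n.+1%:R h1 => N h1; field; rewrite h1 h2.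
Qed.

(** The hypergeometric two-term recursion. It is the differential equation read on coefficients, and
    it also controls their growth in [coef_lag_le]. At m = n the factor m - n vanishes exactly where
    the polynomial stops. *)
Lemma coef_lagS a n m : 0 <= a ->
  (lag a n)`_m.+1 * (m.+1%:R * (m%:R + a + 1)) = (m%:R - n%:R) * (lag a n)`_m.
Proof.
move=> a0; rewrite !coef_poly ltnS.
have [mn|nm|->] := ltngtP m n; last 2 first.
- by rewrite ltnS leqNgt nm/= mul0r mulr0.
- by rewrite leqnn subrr !mul0r.
rewrite ltnS (ltnW mn).
rewrite GammaS_natr// factS natrM exprS.
have -> : (n - m = (n - m.+1).+1)%N by rewrite subnSK.
rewrite factS natrM.
have -> : (n - m.+1).+1%:R = n%:R - m%:R :> R by rewrite subnSK// natrB// ltnW.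
have h0 : n%:R - m%:R != 0 :> R by rewrite subr_eq0 eqr_nat gt_eqF.
have h1 : m.+1%:R != 0 :> R by rewrite pnatr_eq0.
have h2 j : j`!%:R != 0 :> R by rewrite pnatr_eq0 -lt0n fact_gt0.
have h3 : Gamma (m%:R + a + 1) != 0 by rewrite gt_eqF// Gamma_natr_gt0.
have h4 : m%:R + a + 1 != 0 by rewrite gt_eqF// ltr_wpDl// addr_ge0.
move: h0 h1 (h2 m) (h2 (n - m.+1)%N) h3 h4.
rewrite -[m%:R - n%:R]opprB.
move: (n%:R - m%:R) m.+1%:R (m%:R + a + 1) (Gamma (n%:R + a + 1))
  (Gamma (m%:R + a + 1)) m`!%:R (n - m.+1)`!%:R ((-1) ^+ m).
move=> d M b G1 G2 f1 f2 e h0 h1 hf1 hf2 h3 h4.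
by field; rewrite h0 h1 hf1 hf2 h3 h4.
Qed.

Lemma coef_derivE p m : p^`()`_m = p`_m.+1 * m.+1%:R.
Proof. by rewrite coef_deriv mulr_natr. Qed.

Lemma poly_ode_coef p (b c : R) :
  (forall m, p`_m.+1 * (m.+1%:R * (m%:R + b)) = (m%:R - c) * p`_m) ->
  'X * p^`()^`() + (b%:P - 'X) * p^`() + c%:P * p = 0.
Proof.
move=> h; apply/polyP => m; rewrite mulrBl !coefD coefN !coefXM !coefCM coef0.
have {h} := h m; case: m => [|m] /=; rewrite !coef_derivE.
  by rewrite !mulr0n => h; lra.
by rewrite -(natr1 m.+1) -(natr1 m) => h; lra.
Qed.

Lemma lag_ode a n : 0 <= a ->
  'X * (lag a n)^`()^`() + ((a + 1)%:P - 'X) * (lag a n)^`() + n%:R%:P * lag a n = 0.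
Proof. by move=> a0; apply: poly_ode_coef => m; rewrite addrA coef_lagS. Qed.

Lemma deriv_lagS a n : (lag a n.+1)^`() = - lag (a + 1) n.
Proof.
apply/polyP => m; rewrite coef_derivE coefN !coef_poly ltnS.
case: ifP => mn; last by rewrite mul0r oppr0.
rewrite subSS factS natrM exprS.
have gE j : j.+1%:R + a + 1 = j%:R + (a + 1) + 1 by rewrite -natr1; ring.
rewrite !gE.
have h1 : m.+1%:R != 0 :> R by rewrite pnatr_eq0.
move: m.+1%:R h1 => M h1.
move: (Gamma _ / _) m`!%:R ((-1) ^+ m) => G f e; rewrite invfM.
transitivity (- (G * (e / f)) * (M^-1 * M)); first by ring.
by rewrite mulVf// mulr1.
Qed.

Lemma deriv_lag0 a : (lag a 0)^`() = 0.
Proof.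
by apply/polyP => m; rewrite coef_derivE coef_poly ltnS ltn0 mul0r coef0.
Qed.

Lemma lag0 a : 0 <= a -> lag a 0 = 1.
Proof.
move=> a0; apply/polyP => m; rewrite coef_poly ltnS leqn0 coef1; case: eqP => // ->.
rewrite subn0 fact0 mulr1 expr0 invr1 !mulr1 divff//.
by rewrite gt_eqF// Gamma_natr_gt0.
Qed.

(** The differential equation in self-adjoint form, -(t w L')' = n w L, tested against p. The
    symmetry of the right-hand side in the two derivatives gives orthogonality, and the choice p = L
    gives the norms. *)
Lemma moment_lagM a n p : 0 <= a ->
  n%:R * moment a (lag a n * p) = moment a ('X * ((lag a n)^`() * p^`())).
Proof.
move=> a0; have := lag_ode n a0; set L := lag a n => ode.
have := moment_by_parts (L^`() * p) a0.
rewrite derivM mulrDr raddfD/=.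
have -> : 'X * (L^`()^`() * p) =
  'X * (L^`() * p) - (a + 1) *: (L^`() * p) - n%:R *: (L * p).
  apply/eqP; rewrite eq_sym -subr_eq0; apply/eqP.
  rewrite -[RHS](mul0r (- p)) -ode -!mul_polyC; ring.
rewrite !raddfB/= !linearZ/= /GRing.scale/= => h; lra.
Qed.

(** Induction on n with a free: the derivative of L_(n+1) is, up to sign, L_n with parameter a + 1,
    and the factor t of [moment_lagM] turns the weight into the one for a + 1. *)
Lemma moment_lag_lag a n : 0 <= a -> moment a (lag a n * lag a n) = lag_norm a n.
Proof.
elim: n a => [|n IH] a a0.
  by rewrite lag0// mulr1 -(expr0 'X) momentXn /lag_norm fact0 divr1.
have n0 : n.+1%:R != 0 :> R by rewrite pnatr_eq0.
apply: (mulfI n0); rewrite moment_lagM// deriv_lagS mulrNN momentMX IH ?addr_ge0//.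
have -> : lag_norm a n.+1 = lag_norm (a + 1) n / n.+1%:R.
  rewrite /lag_norm factS natrM invfM mulrA mulrAC.
  by have -> : n.+1%:R + a + 1 = n%:R + (a + 1) + 1 by rewrite -natr1; ring.
by rewrite mulrC divfK.
Qed.

Lemma moment_lag_orth a n k : 0 <= a -> n != k -> moment a (lag a n * lag a k) = 0.
Proof.
move=> a0 nk; have h1 := moment_lagM n (lag a k) a0.
have := moment_lagM k (lag a n) a0.
rewrite [lag a k * _]mulrC [_^`() * _]mulrC -h1 => h2.
apply/eqP; have : (n%:R - k%:R : R) * moment a (lag a n * lag a k) == 0.
  by rewrite mulrBl h2 subrr.
by rewrite mulf_eq0 subr_eq0 eqr_nat (negbTE nk).
Qed.

Lemma moment_deriv_lag a n : 0 <= a ->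
  moment a ('X * ((lag a n)^`() * (lag a n)^`())) = n%:R * lag_norm a n.
Proof. by move=> a0; rewrite -moment_lagM// moment_lag_lag. Qed.

End laguerre_polynomials.

(** * Growth of the norms and behaviour near the origin *)

Section laguerre_near_zero.
Context {R : realType}.
Implicit Types (a t : R) (n m : nat).

(** The bounds exp(y) >= 1 + y and ln t >= 1 - 1/t. The form with 1/t is made for ratios of
    consecutive terms: at t = (k + 1)/k the bracket is exactly 1/(k + 1). *)
Lemma powR_ge1D a t : 0 <= a -> 0 < t -> 1 + a * (1 - t^-1) <= t `^ a.
Proof.
move=> a0 t0; rewrite /powR gt_eqF// (le_trans _ (expR_ge1Dx _))// lerD2l ler_wpM2l//.
have := expR_ge1Dx (- ln t); rewrite expRN lnK ?posrE// => h; lra.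
Qed.

(** The successive ratio of the norms is 1 + a/(n + 2), which is exactly the bound of [powR_ge1D] at
    t = (n + 2)/(n + 1). The index is shifted by one because the power of 0 would be 0 for a > 0. *)
Lemma lag_norm_le a n : 0 <= a ->
  lag_norm a n.+1 <= Gamma (a + 1 + 1) * n.+1%:R `^ a.
Proof.
move=> a0; elim: n => [|n IH].
  by rewrite /lag_norm divr1 powR1 mulr1 (_ : 1%:R + a = a + 1)// addrC.
rewrite lag_normS//.
have n1 : 0 < n.+1%:R :> R by rewrite ltr0n.
have n2 : 0 < n.+2%:R :> R by rewrite ltr0n.
have h0 : 0 <= (n.+1%:R + a + 1) / n.+2%:R by rewrite divr_ge0 ?addr_ge0// ltW.
rewrite (le_trans (ler_wpM2r h0 IH))// -mulrA ler_wpM2l ?(ltW (Gamma_gt0 _)) ?addr_ge0//.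
have -> : n.+2%:R `^ a = n.+1%:R `^ a * (n.+2%:R / n.+1%:R) `^ a.
  by rewrite -powRM ?divr_ge0// mulrC divfK// gt_eqF.
rewrite ler_wpM2l ?powR_ge0//.
rewrite (le_trans _ (powR_ge1D a0 _)) ?divr_gt0// invf_div.
rewrite le_eqVlt; apply/orP; left; apply/eqP.
move: n1 n2; rewrite -(natr1 n.+1) => n1 n2; field.
by rewrite gt_eqF.
Qed.

(** The shift by a + 1 inside the power turns the inverse successive ratio (n + 1)/(n + a + 1) into
    the exact bound of [powR_ge1D] at t = (n + a + 1)/(n + a + 2), with equality at n = 0. *)
Lemma lag_norm_ge a n : 0 <= a ->
  Gamma (a + 1) * ((n%:R + a + 1) / (a + 1)) `^ a <= lag_norm a n.
Proof.
move=> a0; have a1 : 0 < a + 1 by rewrite ltr_wpDl.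
elim: n => [|n IH].
  by rewrite /lag_norm add0r fact0 !divr1 divff ?gt_eqF// powR1 mulr1.
have b0 : 0 < n%:R + a + 1 by rewrite ltr_wpDl// addr_ge0.
have b1 : 0 < n.+1%:R + a + 1 by rewrite ltr_wpDl// addr_ge0.
have n1 : 0 < n.+1%:R :> R by rewrite ltr0n.
have h : n.+1%:R / (n%:R + a + 1) <= ((n%:R + a + 1) / (n.+1%:R + a + 1)) `^ a.
  rewrite (le_trans _ (powR_ge1D a0 _)) ?divr_gt0// invf_div.
  rewrite le_eqVlt; apply/orP; left; apply/eqP.
  rewrite -natr1; field.
  by rewrite gt_eqF.
rewrite lag_normS//.
apply: le_trans (ler_wpM2r _ IH); last by rewrite divr_ge0// ltW.
rewrite -mulrA ler_wpM2l ?(ltW (Gamma_gt0 _))//.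
have -> : (n%:R + a + 1) / (a + 1) =
    ((n.+1%:R + a + 1) / (a + 1)) * ((n%:R + a + 1) / (n.+1%:R + a + 1)).
  by move: b1; move: (n.+1%:R + a + 1) => B b1; field; rewrite !gt_eqF.
have X0 : 0 <= (n.+1%:R + a + 1) / (a + 1) by rewrite divr_ge0// ltW.
have Y0 : 0 <= (n%:R + a + 1) / (n.+1%:R + a + 1) by rewrite divr_ge0// ltW.
move: ((n.+1%:R + a + 1) / (a + 1)) X0 => X X0; rewrite powRM//.
rewrite -mulrA -[leLHS]mulr1 ler_wpM2l ?powR_ge0//.
by rewrite -ler_pdivrMr ?divr_gt0// invf_div mul1r.
Qed.

Lemma expR_partial_sum t n : 0 <= t -> \sum_(m < n) t ^+ m / m`!%:R <= expR t.
Proof.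
move=> t0; rewrite /expR.
have -> : \sum_(m < n) t ^+ m / m`!%:R = series (exp_coeff t) n.
  by rewrite /series/= big_mkord; apply: eq_bigr => i _; rewrite exp_coeffE// mulrC.
apply: nondecreasing_cvgn_le; last exact: is_cvg_series_exp_coeff.
apply/nondecreasing_seqP => k; rewrite /series/= big_nat_recr//= lerDl.
by rewrite exp_coeffE// mulr_ge0 ?exprn_ge0.
Qed.

Lemma coef0_lag a n : (lag a n)`_0 = lag_norm a n / Gamma (a + 1).
Proof.
rewrite coef_poly/= subn0 expr0 fact0 divr1 mulr1 add0r.
by rewrite /lag_norm invfM mulrA mulrAC.
Qed.

(** In the recursion, |m - n| <= n and m + a + 1 >= m + 1 >= 1. The polynomial is therefore
    dominated by the exponential series of n t, scaled by its value at 0. *)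
Lemma coef_lag_le a n m : 0 <= a ->
  `|(lag a n)`_m| <= (lag a n)`_0 * (n%:R ^+ m / m`!%:R).
Proof.
move=> a0; have c0 : 0 <= (lag a n)`_0.
  by rewrite coef0_lag divr_ge0 ?ltW ?lag_norm_gt0 ?Gamma_gt0.
elim: m => [|m IH]; first by rewrite expr0 fact0 divr1 mulr1 ger0_norm.
have [nm|mn] := ltnP m n; last first.
  rewrite [X in `|X|](_ : _ = 0) ?normr0 ?mulr_ge0 ?divr_ge0 ?exprn_ge0//.
  by rewrite coef_poly ltnS ltnNge mn.
have m1 : 0 < m.+1%:R :> R by rewrite ltr0n.
have b0 : 0 < m%:R + a + 1 by rewrite ltr_wpDl// addr_ge0.
have := @coef_lagS _ a n m a0 => /(congr1 Num.norm); rewrite !normrM.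
rewrite (gtr0_norm m1) (gtr0_norm b0) => h.
have hn : `|m%:R - n%:R : R| <= n%:R.
  by rewrite distrC ger0_norm ?subr_ge0 ?ler_nat ?(ltnW nm)// gerBl.
have h1 : `|(lag a n)`_m.+1| * m.+1%:R <= n%:R * `|(lag a n)`_m|.
  apply: le_trans (ler_wpM2r (normr_ge0 _) hn).
  rewrite -h mulrA ler_peMr ?mulr_ge0//.
  by rewrite lerDr addr_ge0.
rewrite -ler_pdivlMr// in h1; apply: le_trans h1 _.
rewrite ler_pdivrMr//.
apply: le_trans (ler_wpM2l _ IH) _ => //.
rewrite factS natrM exprS le_eqVlt; apply/orP; left; apply/eqP.
have f0 : m`!%:R != 0 :> R by rewrite pnatr_eq0 -lt0n fact_gt0.
move: m.+1%:R m1 m`!%:R f0 => M m1 f f0.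
by field; rewrite f0 gt_eqF.
Qed.

Lemma lag_near0 a n t : 0 <= a -> 0 <= t ->
  `|(lag a n).[t] - lag_norm a n / Gamma (a + 1)| <=
    lag_norm a n / Gamma (a + 1) * (expR (n%:R * t) - 1).
Proof.
move=> a0 t0; rewrite -coef0_lag.
rewrite (horner_coef_wide _ (size_poly _ _)) big_ord_recl/= expr0 mulr1 addrAC subrr add0r.
have := @expR_partial_sum (n%:R * t) n.+1 (mulr_ge0 (ler0n _ _) t0).
rewrite big_ord_recl/= expr0 fact0 divr1 -lerBrDl => h.
have c0 : 0 <= (lag a n)`_0.
  by rewrite coef0_lag divr_ge0 ?ltW ?lag_norm_gt0 ?Gamma_gt0.
apply: le_trans (ler_wpM2l c0 h).
rewrite mulr_sumr (le_trans (ler_norm_sum _ _ _))// ler_sum// => i _.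
rewrite normrM normrX (ger0_norm t0) /bump/= exprMn.
rewrite (le_trans (ler_wpM2r (exprn_ge0 _ t0) (coef_lag_le _ _ a0)))//.
by rewrite le_eqVlt; apply/orP; left; apply/eqP; ring.
Qed.

Lemma lag_le_expR a n t : 0 <= a -> 0 <= t ->
  `|(lag a n).[t]| <= lag_norm a n / Gamma (a + 1) * expR (n%:R * t).
Proof.
move=> a0 t0; set D := lag_norm a n / Gamma (a + 1).
have D0 : 0 <= D by rewrite divr_ge0 ?ltW ?lag_norm_gt0 ?Gamma_gt0.
have := lag_near0 n a0 t0; rewrite -/D mulrBr mulr1 lerBrDr => h.
apply: le_trans h.
rewrite -{1}(subrK D ((lag a n).[t])) (le_trans (ler_normD _ _))//.
by rewrite (ger0_norm D0).
Qed.

End laguerre_near_zero.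

(** * The bound on the three ranges of t *)

Section laguerre_uniform_bound.
Context {R : realType}.
Implicit Types (a t : R) (n m : nat) (p : {poly R}).
Local Notation mu := (@lebesgue_measure R).

(** The linear coefficient of the potential [sonin_q] in the equation for sqrt(w) L_n. The potential
    increases up to t = 2 kappa, which is why the Sonin argument stops there. *)
Definition kappa a n : R := n%:R + (a + 1) / 2.

Definition sonin_poly a n : {poly R} :=
  ((a / 2)%:P - 2^-1 *: 'X) * lag a n + 'X * (lag a n)^`().

(** Made of the constant of [lag_norm_le], the bound 2(a^2 + 1) for t times max(n, 1), the value of
    L_n at 0 and the square of its exponential majorant. *)
Definition near_const a : R :=
  Gamma (a + 1 + 1) * (2 * (a ^+ 2 + 1)) `^ a / Gamma (a + 1) ^+ 2
    * expR (a ^+ 2 + 1) ^+ 2.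

Lemma near_const_ge0 a : 0 <= a -> 0 <= near_const a.
Proof.
move=> a0; rewrite /near_const mulr_ge0 ?exprn_ge0 ?expR_ge0//.
rewrite divr_ge0 ?exprn_ge0 ?(ltW (Gamma_gt0 _))// mulr_ge0 ?powR_ge0//.
by rewrite (ltW (Gamma_gt0 _))// addr_ge0.
Qed.

Lemma lag_ratio_ge0 a n : 0 <= a -> 0 <= lag_norm a n / Gamma (a + 1).
Proof. by move=> a0; rewrite divr_ge0 ?(ltW (lag_norm_gt0 _ a0)) ?(ltW (Gamma_gt0 a0)). Qed.

Lemma weight_near0 a n t : 0 <= a -> 0 < t -> kappa a n * t <= a ^+ 2 + 1 ->
  weight a t * (lag_norm a n / Gamma (a + 1) * expR (a ^+ 2 + 1)) ^+ 2 <=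
  near_const a * lag_norm a n.
Proof.
move=> a0 t0 kt; set A := a ^+ 2 + 1.
have A0 : 0 < A by rewrite ltr_wpDl// sqr_ge0.
have r0 := lag_norm_gt0 n a0.
have G0 := Gamma_gt0 a0.
have G1 : 0 < Gamma (a + 1 + 1) by rewrite Gamma_gt0// addr_ge0.
have t2A : t <= 2 * A.
  rewrite -(@ler_pM2l _ (2^-1))// mulrA mulVf// mul1r.
  apply: le_trans kt; rewrite ler_pM2r// /kappa.
  have : (0 : R) <= n%:R by []. lra.
(* The norm grows like n^a, compensated by t^a as n t <= kappa t <= A. For n = 0 only kappa >= 1/2
   is available, whence t <= 2A and the factor 2. *)
have rt : lag_norm a n * t `^ a <= Gamma (a + 1 + 1) * (2 * A) `^ a.
  move: r0 kt; case: n => [|n] r0 kt.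
    have r1 : lag_norm a 0 <= Gamma (a + 1 + 1).
      by rewrite /lag_norm fact0 divr1 add0r GammaS// ler_peMl ?(ltW G0)// lerDr.
    apply: (ler_pM (ltW r0) (powR_ge0 _ _) r1).
    by rewrite ge0_ler_powR// nnegrE ?(ltW t0)// (le_trans (ltW t0)).
  rewrite (le_trans (ler_wpM2r (powR_ge0 _ _) (lag_norm_le n a0)))//.
  rewrite -mulrA ler_wpM2l ?(ltW G1)// -powRM ?(ltW t0)//.
  rewrite ge0_ler_powR// ?nnegrE ?mulr_ge0 ?(ltW t0) ?(ltW A0)//.
  rewrite (@le_trans _ _ A)//; last by rewrite mulr_natl mulr2n lerDl ltW.
  apply: le_trans kt; rewrite ler_pM2r// /kappa lerDl.
  by rewrite divr_ge0// addr_ge0.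
rewrite /near_const -/A exprMn mulrA [leRHS]mulrAC ler_wpM2r ?exprn_ge0 ?expR_ge0//.
have -> : (lag_norm a n / Gamma (a + 1)) ^+ 2 =
    lag_norm a n * (lag_norm a n / Gamma (a + 1) ^+ 2).
  by rewrite exprMn exprVn expr2 mulrA.
rewrite mulrA [X in X <= _]mulrA.
rewrite [leRHS]mulrAC ler_pM2r ?invr_gt0 ?exprn_gt0// ler_pM2r//.
apply: le_trans rt; rewrite [leRHS]mulrC ler_wpM2r ?(ltW r0)//.
by rewrite /weight ler_piMr ?powR_ge0// expR_le1 oppr_le0 (ltW t0).
Qed.

Lemma lag_sq_near0 a n t : 0 <= a -> 0 < t -> kappa a n * t <= a ^+ 2 + 1 ->
  weight a t * (lag a n).[t] ^+ 2 <= near_const a * lag_norm a n.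
Proof.
move=> a0 t0 kt; apply: le_trans (weight_near0 a0 t0 kt).
rewrite ler_wpM2l ?weight_ge0// -[leLHS]real_normK ?num_real//.
rewrite lerXn2r ?nnegrE//.
  by rewrite mulr_ge0 ?expR_ge0 ?(lag_ratio_ge0 _ a0).
rewrite (le_trans (lag_le_expR n a0 (ltW t0)))// ler_wpM2l//.
  exact: lag_ratio_ge0.
rewrite ler_expR; apply: le_trans kt; rewrite ler_pM2r// /kappa lerDl.
by rewrite divr_ge0// addr_ge0.
Qed.

(** The derivative is a Laguerre polynomial with parameter a + 1 and one degree less. Its value at 0
    is larger by a factor of order n, which the factor t absorbs. *)
Lemma deriv_lag_near0 a n t : 0 <= a -> 0 < t -> kappa a n * t <= a ^+ 2 + 1 ->
  t * `|(lag a n)^`().[t]| <=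
  (a ^+ 2 + 1) * (lag_norm a n / Gamma (a + 1) * expR (a ^+ 2 + 1)).
Proof.
move=> a0 t0 kt; set A := a ^+ 2 + 1.
have A0 : 0 < A by rewrite ltr_wpDl// sqr_ge0.
have G0 := Gamma_gt0 a0.
case: n kt => [|n] kt.
  rewrite deriv_lag0 horner0 normr0 mulr0 mulr_ge0 ?(ltW A0)//.
  by rewrite mulr_ge0 ?expR_ge0 ?(lag_ratio_ge0 _ a0).
have r0 := lag_norm_gt0 n.+1 a0.
have nt : n.+1%:R * t <= A.
  apply: le_trans kt; rewrite ler_pM2r// /kappa lerDl.
  by rewrite divr_ge0// addr_ge0.
rewrite deriv_lagS hornerN normrN.
have a10 : 0 <= a + 1 by rewrite addr_ge0.
rewrite (le_trans (ler_wpM2l (ltW t0) (lag_le_expR n a10 (ltW t0))))//.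
have -> : lag_norm (a + 1) n = n.+1%:R * lag_norm a n.+1.
  rewrite /lag_norm factS natrM invfM.
  have -> : n.+1%:R + a + 1 = n%:R + (a + 1) + 1 by rewrite -natr1; ring.
  by rewrite mulrCA mulVKf// pnatr_eq0.
have -> x : t * (n.+1%:R * lag_norm a n.+1 / Gamma (a + 1 + 1) * x) =
    n.+1%:R * t * (lag_norm a n.+1 / Gamma (a + 1 + 1) * x) by ring.
have G1 : 0 < Gamma (a + 1 + 1) by rewrite Gamma_gt0.
have G01 : Gamma (a + 1) <= Gamma (a + 1 + 1).
  by rewrite GammaS// ler_peMl ?(ltW G0)// lerDr.
have h1 : lag_norm a n.+1 / Gamma (a + 1 + 1) <= lag_norm a n.+1 / Gamma (a + 1).
  by rewrite (ler_pM2l r0) lef_pV2 ?posrE.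
have h2 : expR (n%:R * t) <= expR A.
  by rewrite ler_expR (le_trans _ nt)// ler_pM2r// ler_nat.
have g1 : 0 <= lag_norm a n.+1 / Gamma (a + 1 + 1).
  exact: divr_ge0 (ltW r0) (ltW G1).
apply: ler_pM nt (ler_pM g1 (expR_ge0 _) h1 h2).
  exact: mulr_ge0 (ler0n _ _) (ltW t0).
exact: mulr_ge0 g1 (expR_ge0 _).
Qed.

Lemma sonin_poly_near0 a n t : 0 <= a -> 0 < t -> kappa a n * t <= a ^+ 2 + 1 ->
  weight a t * (sonin_poly a n).[t] ^+ 2 <=
  (a + 2 * (a ^+ 2 + 1)) ^+ 2 * (near_const a * lag_norm a n).
Proof.
move=> a0 t0 kt; set A := a ^+ 2 + 1.
have A0 : 0 < A by rewrite ltr_wpDl// sqr_ge0.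
set D := lag_norm a n / Gamma (a + 1) * expR A.
have D0 : 0 <= D.
  by rewrite mulr_ge0 ?expR_ge0 ?(lag_ratio_ge0 _ a0).
have t2A : t <= 2 * A.
  rewrite -(@ler_pM2l _ (2^-1))// mulrA mulVf// mul1r.
  apply: le_trans kt; rewrite ler_pM2r// /kappa.
  have : (0 : R) <= n%:R by []. lra.
have LD : `|(lag a n).[t]| <= D.
  rewrite (le_trans (lag_le_expR n a0 (ltW t0)))// ler_wpM2l//.
    exact: lag_ratio_ge0.
  rewrite ler_expR; apply: le_trans kt; rewrite ler_pM2r// /kappa lerDl.
  by rewrite divr_ge0// addr_ge0.
have L'D := deriv_lag_near0 a0 t0 kt; rewrite -/A -/D in L'D.
have SD : `|(sonin_poly a n).[t]| <= (a + 2 * A) * D.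
  rewrite /sonin_poly !(hornerD, hornerM, hornerN, hornerZ, hornerC, hornerX).
  rewrite (le_trans (ler_normD _ _))// !normrM (gtr0_norm t0).
  have h : `|a / 2 - 2^-1 * t| <= a + A.
    rewrite ler_norml; apply/andP; split; lra.
  have h2 := ler_pM (normr_ge0 _) (normr_ge0 _) h LD.
  lra.
have := weight_near0 a0 t0 kt; rewrite -/A -/D => h.
rewrite (le_trans _ (ler_wpM2l (sqr_ge0 _) h))//.
rewrite [leRHS]mulrCA ler_wpM2l ?weight_ge0// -exprMn -[leLHS]real_normK ?num_real//.
by rewrite lerXn2r ?nnegrE// mulr_ge0// addr_ge0// mulr_ge0// ltW.
Qed.

Definition sonin_q a n : {poly R} :=
  kappa a n *: 'X - 4^-1 *: 'X^2 - (a ^+ 2 / 4)%:P.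

(* [sqrt w * L_n] solves [t (t u')' + q u = 0] with [q = sonin_q a n]; writing
   [t u' = sqrt w * S] with [S = sonin_poly a n], this is Sonin's function
   [u^2 + (t u')^2 / q], whose derivative is [- q' (t u')^2 / q^2]. *)
Definition sonin a n t : R :=
  weight a t * ((lag a n).[t] ^+ 2 + (sonin_poly a n).[t] ^+ 2 / (sonin_q a n).[t]).

Lemma horner_sonin_q a n t :
  (sonin_q a n).[t] = kappa a n * t - t ^+ 2 / 4 - a ^+ 2 / 4.
Proof. by rewrite /sonin_q !(hornerD, hornerN, hornerZ, hornerC, hornerX, hornerXn); ring. Qed.

Lemma horner_deriv_sonin_q a n t : (sonin_q a n)^`().[t] = kappa a n - t / 2.
Proof.
rewrite /sonin_q !(derivB, derivZ, derivX, derivXn, derivC).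
rewrite !(hornerD, hornerN, hornerZ, hornerMn, hornerC, hornerX, hornerXn)/=.
lra.
Qed.

Lemma horner_sonin_poly a n t : (sonin_poly a n).[t] =
  (a - t) / 2 * (lag a n).[t] + t * (lag a n)^`().[t].
Proof.
by rewrite /sonin_poly !(hornerD, hornerM, hornerN, hornerZ, hornerC, hornerX); ring.
Qed.

(** The second half of the equation written as a first-order system: t (sqrt(w) S)' = - q sqrt(w)
    L. *)
Lemma horner_deriv_sonin_poly a n t : 0 <= a ->
  t * (sonin_poly a n)^`().[t] =
  - (sonin_q a n).[t] * (lag a n).[t] - (a - t) / 2 * (sonin_poly a n).[t].
Proof.
move=> a0; have := congr1 (fun p => p.[t]) (lag_ode n a0).
rewrite horner_sonin_poly horner_sonin_q /sonin_poly.
rewrite !(derivD, derivN, derivM, derivZ, derivX, derivC).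
rewrite !(hornerD, hornerM, hornerN, hornerZ, hornerC, hornerX, horner0) /kappa.
move: ((lag a n).[t]) ((lag a n)^`().[t]) ((lag a n)^`()^`().[t]) => P0 P1 P2 ode.
apply/eqP; rewrite -subr_eq0; apply/eqP; rewrite -[RHS](mulr0 t) -[in RHS]ode; by field.
Qed.

Lemma is_derive_sonin a n t : 0 <= a -> 0 < t -> (sonin_q a n).[t] != 0 ->
  is_derive t 1 (sonin a n)
    (- (weight a t * (sonin_poly a n).[t] ^+ 2 * (sonin_q a n)^`().[t]
        / (sonin_q a n).[t] ^+ 2)).
Proof.
move=> a0 t0 q0.
(* The derivative of the weight involves the exponent a - 1. Expressing everything through that
   weight leaves a rational identity in which the mixed terms L S cancel. *)
have wt : weight a t = t * weight (a - 1) t.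
  rewrite /weight; have -> : t `^ a = t `^ 1 * t `^ (a - 1).
    by rewrite -powRD ?(gt_eqF t0) ?implybT// addrC subrK.
  by rewrite powRr1 ?(ltW t0)// mulrA.
have dw := is_derive_weight a t0.
have dL := is_derive_poly (lag a n) t.
have dS := is_derive_poly (sonin_poly a n) t.
have dq := is_derive_poly (sonin_q a n) t.
have dL2 : is_derive t 1 (fun x => (lag a n).[x] ^+ 2)
    (2 * (lag a n).[t] * (lag a n)^`().[t]) := is_deriveX 2 dL.
have dS2 : is_derive t 1 (fun x => (sonin_poly a n).[x] ^+ 2)
    (2 * (sonin_poly a n).[t] * (sonin_poly a n)^`().[t]) := is_deriveX 2 dS.
have dq1 : is_derive t 1 (fun x => (sonin_q a n).[x]^-1)
    (- (sonin_q a n).[t] ^- 2 * (sonin_q a n)^`().[t]) := is_deriveV q0 dq.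
have dSq : is_derive t 1 (fun x => (sonin_poly a n).[x] ^+ 2 / (sonin_q a n).[x])
  ((sonin_poly a n).[t] ^+ 2 * (- (sonin_q a n).[t] ^- 2 * (sonin_q a n)^`().[t])
   + (sonin_q a n).[t]^-1 * (2 * (sonin_poly a n).[t] * (sonin_poly a n)^`().[t]))
  := is_deriveM dS2 dq1.
have dsum := is_deriveD dL2 dSq.
apply: trigger_derive (is_deriveM dw dsum) _; rewrite /GRing.scale/=.
have S1 := horner_deriv_sonin_poly n t a0.
have P1 := horner_sonin_poly a n t.
move: q0 S1 P1; rewrite !fctE wt.
move: (weight (a - 1) t) ((lag a n)^`().[t]) ((lag a n).[t]) ((sonin_poly a n).[t])
  ((sonin_poly a n)^`().[t]) ((sonin_q a n).[t]) ((sonin_q a n)^`().[t]).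
move=> w P1 P0 S S1 q q1 q0 tS1 SE.
have t0' : t != 0 by rewrite gt_eqF.
have -> : S1 = (- q * P0 - (a - t) / 2 * S) / t by rewrite -tS1 mulrC mulKf.
have -> : P1 = (S - (a - t) / 2 * P0) / t by rewrite SE addrAC subrr add0r mulrC mulKf.
field.
by rewrite t0' q0.
Qed.

(** Sonin's function dominates w L^2 and decreases from x0 = (a^2 + 1)/kappa, where the estimates
    near zero still apply to both L and S. *)
Lemma lag_sq_middle a n t : 0 <= a -> a ^+ 2 + 1 <= kappa a n * t -> t <= 2 * kappa a n ->
  weight a t * (lag a n).[t] ^+ 2 <=
  (1 + 2 * (a + 2 * (a ^+ 2 + 1)) ^+ 2) * near_const a * lag_norm a n.
Proof.
move=> a0; set A := a ^+ 2 + 1 => At tk.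
have A0 : 0 < A by rewrite ltr_wpDl// sqr_ge0.
have k0 : 0 < kappa a n by rewrite ltr_wpDl// divr_gt0// ltr_wpDl.
set x0 := A / kappa a n.
have x00 : 0 < x0 by rewrite divr_gt0.
have kx0 : kappa a n * x0 = A by rewrite mulrC divfK// gt_eqF.
have x0t : x0 <= t by rewrite ler_pdivrMr// mulrC.
(* Up to 2 kappa the quadratic term costs at most half of kappa x, so q >= (a^2 + 1)/2 - a^2/4 >=
   1/2. This dictates the threshold a^2 + 1, and 1/q <= 2 is the factor 2 in the constant. *)
have q_ge x : x0 <= x -> x <= 2 * kappa a n -> 2^-1 <= (sonin_q a n).[x].
  move=> x0x xk; rewrite horner_sonin_q.
  have h1 : A <= kappa a n * x by rewrite -kx0 ler_pM2l.
  have h2 : 0 <= x * (2 * kappa a n - x).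
    by rewrite mulr_ge0 ?subr_ge0// (le_trans (ltW x00)).
  have h3 := sqr_ge0 a.
  rewrite /A in h1; nra.
have q_gt0 x : x0 <= x -> x <= 2 * kappa a n -> 0 < (sonin_q a n).[x].
  by move=> h1 h2; rewrite (lt_le_trans _ (q_ge _ h1 h2)).
have dF x : x \in `[x0, t] -> is_derive x 1 (sonin a n)
    (- (weight a x * (sonin_poly a n).[x] ^+ 2 * (sonin_q a n)^`().[x]
        / (sonin_q a n).[x] ^+ 2)).
  rewrite in_itv/= => /andP[x0x xt]; apply: is_derive_sonin => //.
    exact: lt_le_trans x0x.
  by rewrite gt_eqF// q_gt0// (le_trans xt).
have Ft : sonin a n t <= sonin a n x0.
  apply: (@ler0_derive1_nincr _ (sonin a n) x0 t) => //.
  - move=> x /subset_itv_oo_cc xI; exact: (@ex_derive _ _ _ _ _ _ _ (dF _ xI)).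
  - move=> x /subset_itv_oo_cc xI; rewrite derive1E.
    rewrite (@derive_val _ _ _ _ _ _ _ (dF _ xI)) oppr_le0.
    have q'0 : 0 <= (sonin_q a n)^`().[x].
      rewrite horner_deriv_sonin_q; move: xI; rewrite in_itv/= => /andP[_ xt].
      lra.
    exact: divr_ge0 (mulr_ge0 (mulr_ge0 (weight_ge0 _ _) (sqr_ge0 _)) q'0) (sqr_ge0 _).
  - by apply: derivable_within_continuous => x xI; exact: (@ex_derive _ _ _ _ _ _ _ (dF _ xI)).
have hx0 := @lag_sq_near0 a n _ a0 x00; rewrite -/A kx0 in hx0.
have hs := @sonin_poly_near0 a n _ a0 x00; rewrite -/A kx0 in hs.
apply: (@le_trans _ _ (sonin a n t)).
  rewrite /sonin ler_wpM2l ?weight_ge0// lerDl.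
  by rewrite divr_ge0 ?sqr_ge0// ltW// q_gt0.
apply: le_trans Ft _; rewrite /sonin mulrDr mulrDl mul1r [leRHS]mulrDl lerD ?hx0//.
have := hs (lexx _) => {}hs.
have x0k : x0 <= 2 * kappa a n by exact: le_trans tk.
have qi : (sonin_q a n).[x0]^-1 <= 2.
  by rewrite -[leRHS]invrK lef_pV2 ?posrE ?invr_gt0 ?q_ge ?q_gt0.
have w0 : 0 <= weight a x0 * (sonin_poly a n).[x0] ^+ 2.
  by rewrite mulr_ge0 ?weight_ge0 ?sqr_ge0.
rewrite mulrA (le_trans (ler_wpM2l w0 qi))//.
by have := ler_wpM2l (ler0n R 2) hs; lra.
Qed.

Lemma integral_weight_poly a p : 0 <= a ->
  (\int[mu]_(t in `]0%R, +oo[) (weight a t * p.[t])%:E = (moment a p)%:E)%E.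
Proof.
move=> a0; have ip := integrable_poly p a0.
have mp : measurable_fun setT (EFin \o (horner p : measurableTypeR R -> R)).
  exact: measurable_int ip.
rewrite -(Rintegral_poly p a0) /Rintegral fineK; last exact: integrable_fin_num.
by rewrite integral_wmeasure.
Qed.

Lemma measurable_weight_poly a p (A : set (measurableTypeR R)) :
  measurable_fun A (fun t => (weight a t * p.[t])%:E).
Proof.
apply/measurable_EFinP; apply: measurable_funM; first exact: measurable_weight.
apply: measurable_funTS; apply: continuous_measurable_fun.
exact: continuous_horner.
Qed.

Lemma integral_weight_poly_le a p (x y : R) : 0 <= a -> 0 < x ->
  (forall t, 0 < t -> 0 <= p.[t]) ->
  (\int[mu]_(t in `[x, y]) (weight a t * p.[t])%:E <= (moment a p)%:E)%E.
Proof.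
move=> a0 x0 p0; rewrite -integral_weight_poly//.
apply: ge0_subset_integral => //.
- exact: measurable_weight_poly.
- move=> t /=; rewrite in_itv/= andbT => t0.
  by rewrite lee_fin mulr_ge0 ?weight_ge0 ?p0.
- by move=> t /=; rewrite !in_itv/= andbT => /andP[xt _]; exact: lt_le_trans xt.
Qed.

(** Otherwise w L^2 would exceed its total integral on all of [x, x + 2], and its integral there
    would be at least twice the total. *)
Lemma lag_sq_small_value a n x : 0 <= a -> 0 < x ->
  exists2 y, x <= y & weight a y * (lag a n).[y] ^+ 2 <= lag_norm a n.
Proof.
move=> a0 x0; apply: contrapT => h.
have gt_r y : x <= y -> lag_norm a n < weight a y * (lag a n * lag a n).[y].
  by move=> xy; rewrite hornerM -expr2 ltNge; apply/negP => ?; apply: h; exists y.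
have r0 := lag_norm_gt0 n a0.
have /= := @integral_weight_poly_le a (lag a n * lag a n) x (x + 2) a0 x0.
rewrite moment_lag_lag// => /(_ _)/wrap[].
  by move=> t _; rewrite hornerM -expr2 sqr_ge0.
apply/negP; rewrite -ltNge.
apply: (@lt_le_trans _ _ (\int[mu]_(t in `[x, (x + 2)%R]) (lag_norm a n)%:E)%E).
  rewrite integral_cst//= lebesgue_measure_itv/= lte_fin ltrDl ltr0n/=.
  by rewrite -EFinB -EFinM lte_fin addrAC subrr add0r ltr_pMr// ltr1n.
apply: ge0_le_integral => //.
- by move=> t _; rewrite lee_fin ltW.
- exact: measurable_weight_poly.
- by move=> t; rewrite /= in_itv/= => /andP[xt _]; rewrite lee_fin ltW// gt_r.
Qed.

(** The constant 4 is 1 for the value at y plus 3 for the variation between x and y: 2 from the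
    integral of w L^2, and 1 from that of w t L'^2 after division by 2 kappa. *)
Lemma lag_sq_far a n x : 0 <= a -> 2 * kappa a n <= x ->
  weight a x * (lag a n).[x] ^+ 2 <= 4 * lag_norm a n.
Proof.
move=> a0 kx; have k0 : 0 < kappa a n by rewrite ltr_wpDl// divr_gt0// ltr_wpDl.
have x0 : 0 < x by rewrite (lt_le_trans _ kx)// mulr_gt0.
have r0 := lag_norm_gt0 n a0.
have [y xy gy] := @lag_sq_small_value a n x a0 x0.
move: xy; rewrite le_eqVlt => /predU1P[->|xy].
  by rewrite (le_trans gy)// ler_peMl ?ler1n// ltW.
pose L := lag a n.
pose g t := - (weight a t * L.[t] ^+ 2).
pose g' t := weight a t * L.[t] ^+ 2 - a * weight (a - 1) t * L.[t] ^+ 2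
             - weight a t * (2 * L.[t] * L^`().[t]).
have dg t : 0 < t -> is_derive t 1 g (g' t).
  move=> t0; have dw := is_derive_weight a t0.
  have dL := is_derive_poly L t.
  have dL2 : is_derive t 1 (fun x => L.[x] ^+ 2) (2 * L.[t] * L^`().[t]) := is_deriveX 2 dL.
  apply: trigger_derive (is_deriveN (is_deriveM dw dL2)) _.
  by rewrite /g' /GRing.scale/=; ring.
(* [- 2 L L' <= L^2 + L'^2], and [L'^2 <= t L'^2 / (2 kappa)] on [x, +oo[. *)
pose h : {poly R} := 2%:R *: (L * L) + (2 * kappa a n)^-1 *: ('X * (L^`() * L^`())).
have hE t : h.[t] = 2 * L.[t] ^+ 2 + (2 * kappa a n)^-1 * (t * L^`().[t] ^+ 2).
  by rewrite /h !(hornerD, hornerZ, hornerM, hornerX) !expr2.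
have hle : moment a h <= 3 * lag_norm a n.
  rewrite /h raddfD/= !linearZ/= moment_lag_lag// moment_deriv_lag// /GRing.scale/=.
  have : (2 * kappa a n)^-1 * (n%:R * lag_norm a n) <= lag_norm a n.
    rewrite mulrA ler_piMl ?(ltW r0)// mulrC ler_pdivrMr ?mulr_gt0//.
    rewrite mul1r /kappa; have : (0 : R) <= n%:R by []. lra.
  lra.
have cw b t : x <= t -> {for t, continuous (weight b)}.
  by move=> xt; apply: weight_continuous; exact: lt_le_trans xt.
have cg' : {within `[x, y], continuous g'}.
  apply: continuous_in_subspaceT => t; rewrite inE/= in_itv/= => /andP[xt _].
  have cL : {for t, continuous (horner L)} by exact: continuous_horner.
  have cL' : {for t, continuous (horner L^`())} by exact: continuous_horner.
  have cL2 : {for t, continuous (fun t => L.[t] ^+ 2)}.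
    rewrite (_ : (fun t => _) = (fun t => L.[t] * L.[t])); first exact: cvgM.
    by apply/funext => z; rewrite expr2.
  apply: cvgB; first apply: cvgB.
  + by apply: cvgM; [exact: cw|exact: cL2].
  + apply: cvgM; last exact: cL2.
    by apply: cvgM; [exact: cvg_cst|exact: cw].
  + apply: cvgM; first exact: cw.
    apply: cvgM; last exact: cL'.
    by apply: cvgM; [exact: cvg_cst|exact: cL].
have FTC : (\int[mu]_(t in `[x, y]) (g' t)%:E = (g y)%:E - (g x)%:E)%E.
  have dgc t : x <= t -> derivable g t 1.
    by move=> xt; exact: (@ex_derive _ _ _ _ _ _ _ (dg _ (lt_le_trans x0 xt))).
  have cg t : x <= t -> {for t, continuous g}.
    by move=> xt; apply: differentiable_continuous; apply/derivable1_diffP; exact: dgc.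
  apply: continuous_FTC2 => //.
  - split.
    + by move=> t; rewrite in_itv/= => /andP[/ltW xt _]; exact: dgc.
    + by apply: cvg_at_right_filter; exact: cg.
    + by apply: cvg_at_left_filter; apply: cg; exact: ltW.
  - move=> t; rewrite in_itv/= => /andP[xt _]; rewrite derive1E.
    exact: (@derive_val _ _ _ _ _ _ _ (dg _ (lt_trans x0 xt))).
have : (\int[mu]_(t in `[x, y]) (g' t)%:E <=
        \int[mu]_(t in `[x, y]) (weight a t * h.[t])%:E)%E.
  apply: le_integral => //.
  - by apply: continuous_compact_integrable => //; exact: segment_compact.
  - apply: continuous_compact_integrable; first exact: segment_compact.
    apply: continuous_in_subspaceT => t; rewrite inE/= in_itv/= => /andP[xt _].
    by apply: cvgM; [exact: cw|exact: continuous_horner].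
  - move=> t; rewrite inE/= in_itv/= => /andP[xt _]; rewrite lee_fin hE /g'.
    (* The term that comes from differentiating t^a has a favourable sign and is dropped. *)
    have h1 : 0 <= a * weight (a - 1) t * L.[t] ^+ 2.
      by rewrite mulr_ge0 ?sqr_ge0// mulr_ge0// weight_ge0.
    have h2 : L^`().[t] ^+ 2 <= (2 * kappa a n)^-1 * (t * L^`().[t] ^+ 2).
      rewrite mulrA ler_peMl ?sqr_ge0// mulrC ler_pdivlMr ?mulr_gt0// mul1r.
      exact: le_trans xt.
    have h3 := sqr_ge0 (L.[t] + L^`().[t]).
    have h4 : L.[t] ^+ 2 - 2 * L.[t] * L^`().[t] <=
      2 * L.[t] ^+ 2 + (2 * kappa a n)^-1 * (t * L^`().[t] ^+ 2) by lra.
    have := ler_wpM2l (weight_ge0 a t) h4.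
    rewrite mulrBr; lra.
have h0 t : 0 < t -> 0 <= h.[t].
  move=> t0; rewrite hE addr_ge0// mulr_ge0 ?sqr_ge0//.
    by rewrite invr_ge0 mulr_ge0// ltW.
  by rewrite mulr_ge0 ?sqr_ge0// ltW.
rewrite FTC => /le_trans/(_ (integral_weight_poly_le _ a0 x0 h0)).
by rewrite -EFinB lee_fin /g -/L in gy *; lra.
Qed.

Definition lag_const a : R :=
  4 + (1 + 2 * (a + 2 * (a ^+ 2 + 1)) ^+ 2) * near_const a.

(* The three ranges are: [t <= (a^2 + 1) / kappa], where the power series is
   dominated by its exponential majorant; up to the middle [2 * kappa] of the
   oscillatory range, where Sonin's function decreases; and beyond. *)
Lemma lag_sq_le a n t : 0 <= a -> 0 < t ->
  weight a t * (lag a n).[t] ^+ 2 <= lag_const a * lag_norm a n.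
Proof.
move=> a0 t0; have r0 := lag_norm_gt0 n a0.
have c0 := near_const_ge0 a0.
have s0 := sqr_ge0 (a + 2 * (a ^+ 2 + 1)).
rewrite /lag_const mulrDl.
have h1 : 0 <= 4 * lag_norm a n by rewrite mulr_ge0// ltW.
have h2 : near_const a * lag_norm a n <=
    (1 + 2 * (a + 2 * (a ^+ 2 + 1)) ^+ 2) * near_const a * lag_norm a n.
  by rewrite ler_wpM2r ?(ltW r0)// ler_peMl// lerDl mulr_ge0.
have h3 : 0 <= near_const a * lag_norm a n by rewrite mulr_ge0// ltW.
have [tk|kt] := leP (kappa a n * t) (a ^+ 2 + 1).
  by have := lag_sq_near0 a0 t0 tk; lra.
have [tk|{}kt] := leP t (2 * kappa a n).
  by have := lag_sq_middle a0 (ltW kt) tk; lra.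
by have := lag_sq_far a0 (ltW kt); lra.
Qed.

Lemma ellE a n t :
  ell a n t = Num.sqrt (lag_norm a n)^-1 * (lag a n).[t].
Proof. by rewrite /ell horner_lag /lag_norm invf_div. Qed.

Lemma ell_sq_le a n t : 0 <= a -> 0 < t ->
  weight a t * ell a n t ^+ 2 <= lag_const a.
Proof.
move=> a0 t0; have r0 := lag_norm_gt0 n a0.
rewrite ellE exprMn sqr_sqrtr; last by rewrite invr_ge0 ltW.
by rewrite mulrCA mulrC ler_pdivrMr//; exact: lag_sq_le.
Qed.

Lemma lag_const_ge0 a : 0 <= a -> 0 <= lag_const a.
Proof.
move=> a0; rewrite addr_ge0// mulr_ge0 ?near_const_ge0//.
by rewrite addr_ge0// mulr_ge0// sqr_ge0.
Qed.

Lemma norm_ell_weight_le a n t : 0 <= a -> 0 < t ->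
  `|ell a n t * Num.sqrt (weight a t)| <= Num.sqrt (lag_const a).
Proof.
move=> a0 t0; rewrite -sqrtr_sqr ler_sqrt ?lag_const_ge0//.
by rewrite exprMn sqr_sqrtr ?weight_ge0// mulrC ell_sq_le.
Qed.

(** For n t <= 1/3 one has exp(n t) <= 1/(1 - 1/3) = 3/2, so L_n(t) differs from L_n(0) by at most
    half of L_n(0). *)
Lemma lag_ge a n t : 0 <= a -> 0 < t -> n%:R * t <= 3^-1 ->
  lag_norm a n / Gamma (a + 1) / 2 <= (lag a n).[t].
Proof.
move=> a0 t0 nt; have := lag_near0 n a0 (ltW t0).
set D := lag_norm a n / Gamma (a + 1).
have D0 : 0 <= D by exact: lag_ratio_ge0.
have e : expR (n%:R * t) <= 3 / 2.
  have h := expR_ge1Dx (- (n%:R * t)).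
  rewrite -[leLHS]invrK -expRN -[leRHS]invrK lef_pV2 ?posrE ?expR_gt0//.
  by rewrite invf_div; lra.
rewrite ler_norml => /andP[h _].
have : D * (expR (n%:R * t) - 1) <= D * (3 / 2 - 1) by rewrite ler_wpM2l// lerB.
lra.
Qed.

End laguerre_uniform_bound.

(** * Coefficients of square-integrable functions *)

Section L2w_theory.
Context {R : realType}.
Variable a : R.
Hypothesis a0 : 0 <= a.
Local Notation wm := (wmeasure a).
Implicit Types (f g : measurableTypeR R -> R) (p q : {poly R}) (k n : nat).

Lemma L2w_Lfun (f : L2w a) : (f : measurableTypeR R -> R) \in Lfun wm 2%:E.
Proof.
apply/andP; split; rewrite inE/=.
  have h : @measurable_fun _ _ (measurableTypeR R) (measurableTypeR R) setT f.
    exact: measurable_funPT.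
  exact: h.
exact: Lebesgue_finite.
Qed.

Lemma measurable_Lfun f r : f \in Lfun wm r -> measurable_fun setT f.
Proof. by move=> /andP[/[1!inE]]. Qed.

Lemma Lfun2_integrableM f g : f \in Lfun wm 2%:E -> g \in Lfun wm 2%:E ->
  wm.-integrable setT (EFin \o (fun t => f t * g t)).
Proof. by move=> f2 g2; apply/Lfun1_integrable; exact: Lfun2_mul_Lfun1. Qed.

Lemma Lfun2_of_integrable f : measurable_fun setT f ->
  wm.-integrable setT (EFin \o (fun t => f t ^+ 2)) -> f \in Lfun wm 2%:E.
Proof.
move=> mf /integrableP[_ i2]; apply/andP; split; rewrite inE//=.
rewrite /finite_norm unlock/=; apply: poweR_lty.
apply: le_lt_trans i2; rewrite le_eqVlt; apply/orP; left; apply/eqP.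
by apply: eq_integral => t _ /=; rewrite powR_mulrn// normrX.
Qed.

Lemma measurable_poly p : measurable_fun setT (horner p : measurableTypeR R -> R).
Proof. by apply: continuous_measurable_fun; exact: continuous_horner. Qed.

Lemma Lfun2_poly p : (horner p : measurableTypeR R -> R) \in Lfun wm 2%:E.
Proof.
apply: Lfun2_of_integrable; first exact: measurable_poly.
rewrite (_ : _ \o _ = EFin \o horner (p * p)); first exact: integrable_poly.
by apply/funext => t /=; rewrite hornerM expr2.
Qed.

Lemma innerE f g : measurable_fun setT f -> measurable_fun setT g ->
  inner a f g = \int[wm]_t (f t * g t).
Proof.
move=> mf mg; rewrite /inner /Rintegral integral_wmeasure.
  by congr fine; apply: eq_integral => t _; rewrite -EFinM mulrA.
by apply/measurable_EFinP; exact: measurable_funM.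
Qed.

Lemma inner_poly p q : inner a (horner p) (horner q) = moment a (p * q).
Proof.
rewrite innerE; [|exact: measurable_poly..].
by rewrite -Rintegral_poly//; apply: eq_Rintegral => t _; rewrite hornerM.
Qed.

Lemma innerC f g : inner a f g = inner a g f.
Proof. by apply: eq_Rintegral => t _; rewrite mulrAC. Qed.

Lemma innerBl f g h : f \in Lfun wm 2%:E -> g \in Lfun wm 2%:E -> h \in Lfun wm 2%:E ->
  inner a (f \- g) h = inner a f h - inner a g h.
Proof.
move=> f2 g2 h2.
have mf := measurable_Lfun f2; have mg := measurable_Lfun g2.
have mh := measurable_Lfun h2.
rewrite !innerE//; last exact: measurable_funB.
rewrite -RintegralB//; [|exact: Lfun2_integrableM..].
by apply: eq_Rintegral => t _; rewrite /= mulrBl.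
Qed.

Lemma Lfun2B f g : f \in Lfun wm 2%:E -> g \in Lfun wm 2%:E -> f \- g \in Lfun wm 2%:E.
Proof.
move=> f2 g2.
have mf := measurable_Lfun f2; have mg := measurable_Lfun g2.
apply: Lfun2_of_integrable; first exact: measurable_funB.
rewrite (_ : _ \o _ = ((EFin \o (fun t => f t * f t)%R) \+
  ((EFin \o (fun t => g t * g t)%R) \-
   (fun t => 2%:E * (EFin \o (fun t => f t * g t)%R) t)))%E).
  apply: integrableD => //; first exact: Lfun2_integrableM.
  apply: integrableB => //; first exact: Lfun2_integrableM.
  by apply: integrableZl => //; exact: Lfun2_integrableM.
apply/funext => t.
rewrite -[RHS]/((f t * f t + (g t * g t - 2 * (f t * g t)))%:E) /=.
by congr EFin; ring.
Qed.

Lemma inner_ge0 f : 0 <= inner a f f.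
Proof.
apply: Rintegral_ge0 => t _.
by rewrite -mulrA -expr2 mulr_ge0 ?weight_ge0 ?sqr_ge0.
Qed.

Definition ell_poly k : {poly R} := Num.sqrt (lag_norm a k)^-1 *: lag a k.

Lemma horner_ell_poly k : horner (ell_poly k) = ell a k.
Proof. by apply/funext => t; rewrite hornerZ ellE. Qed.

Lemma ell_orthonormal j k : moment a (ell_poly j * ell_poly k) = (j == k)%:R.
Proof.
rewrite /ell_poly -scalerAl -scalerAr !linearZ/= /GRing.scale/=.
have [->|jk] := eqVneq j k; last by rewrite moment_lag_orth// !mulr0.
have r0 := lag_norm_gt0 k a0.
rewrite moment_lag_lag// mulrA -expr2 sqr_sqrtr ?invr_ge0 ?(ltW r0)//.
by rewrite mulVf// gt_eqF.
Qed.

Definition ell_sum n (c : R^nat) : {poly R} := \sum_(k < n) c k *: ell_poly k.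

Lemma moment_ell_sum n c k : moment a (ell_sum n c * ell_poly k) =
  if (k < n)%N then c k else 0.
Proof.
rewrite /ell_sum mulr_suml raddf_sum/=.
under eq_bigr do rewrite -scalerAl linearZ/= ell_orthonormal.
case: ifPn => [kn|]; last first.
  rewrite -leqNgt => nk; rewrite big1// => i _.
  by rewrite ltn_eqF ?[_ *: _]mulr0// (leq_trans _ nk).
rewrite (bigD1 (Ordinal kn))//= eqxx [_ *: _]mulr1 big1 ?addr0// => i ik.
rewrite (_ : (_ == _) = false) ?[_ *: _]mulr0//.
by apply: contraNF ik => /eqP ik; apply/eqP/val_inj.
Qed.

Lemma moment_ell_sum_sqr n c :
  moment a (ell_sum n c * ell_sum n c) = \sum_(k < n) c k ^+ 2.
Proof.
rewrite {2}/ell_sum mulr_sumr raddf_sum/=; apply: eq_bigr => k _.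
by rewrite -scalerAr linearZ/= moment_ell_sum ltn_ord expr2.
Qed.

Lemma inner_ell_sum f n c : f \in Lfun wm 2%:E ->
  inner a f (horner (ell_sum n c)) = \sum_(k < n) c k * inner a f (ell a k).
Proof.
move=> f2; have mf := measurable_Lfun f2.
rewrite innerE//; last exact: measurable_poly.
under [RHS]eq_bigr => k _.
  rewrite -horner_ell_poly innerE//; last exact: measurable_poly.
  rewrite -RintegralZl//; last exact: Lfun2_integrableM f2 (Lfun2_poly _).
  over.
elim: n => [|n IH].
  rewrite big_ord0 /ell_sum big_ord0.
  under eq_Rintegral do rewrite horner0 mulr0.
  by rewrite Rintegral_cst// mul0r.
rewrite big_ord_recr/= -IH -RintegralD//.
- apply: eq_Rintegral => t _; rewrite /ell_sum big_ord_recr/= hornerD hornerZ; ring.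
- exact: Lfun2_integrableM f2 (Lfun2_poly _).
- apply: (@integrableZl _ _ _ _ _ _ (c n) (EFin \o (fun t => f t * (ell_poly n).[t]))) => //.
  exact: Lfun2_integrableM f2 (Lfun2_poly _).
Qed.

Lemma Bessel f n : f \in Lfun wm 2%:E ->
  \sum_(k < n) inner a f (ell a k) ^+ 2 <= inner a f f.
Proof.
move=> f2; pose c k := inner a f (ell a k); pose s := horner (ell_sum n c).
have s2 : s \in Lfun wm 2%:E by exact: Lfun2_poly.
have := inner_ge0 (f \- s); rewrite innerBl//; last exact: Lfun2B.
rewrite (innerC f) (innerC s) !innerBl// (innerC s f) inner_ell_sum//.
rewrite inner_poly moment_ell_sum_sqr.
under [X in _ - X - _]eq_bigr do rewrite -/(c _) -expr2.
by rewrite subrr subr0 subr_ge0.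
Qed.

(** Turns closeness in the weighted norm into closeness of coefficients, so that one error estimate
    serves both models of noise. *)
Lemma Bessel_coef (f g : L2w a) n :
  \sum_(k < n) (coef g k - coef f k) ^+ 2 <=
  norm2 a ((f : R -> R) \- (g : R -> R)) ^+ 2.
Proof.
have f2 := L2w_Lfun f; have g2 := L2w_Lfun g.
rewrite /norm2 sqr_sqrtr ?inner_ge0//.
apply: le_trans (Bessel n (Lfun2B f2 g2)).
rewrite ler_sum// => k _; rewrite innerBl//; first by rewrite -sqrrN opprB.
by rewrite -horner_ell_poly; exact: Lfun2_poly.
Qed.

(** * Polynomials as elements of the weighted space *)

Section from_poly.
Variable p : {poly R}.

Definition poly_mfun : {mfun (measurableTypeR R) >-> (measurableTypeR R)} :=
  HB.pack (horner p : measurableTypeR R -> measurableTypeR R)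
    (@isMeasurableFun.Build _ _ (measurableTypeR R) (measurableTypeR R)
      (horner p) (measurable_poly p)).

Definition poly_class : {mfun_ wm, measurableTypeR R >-> measurableTypeR R} :=
  (\pi poly_mfun)%qT.

Lemma poly_class_ae : (poly_class : measurableTypeR R -> R) = horner p %[ae wm].
Proof.
have /eqP := reprK poly_class; rewrite /poly_class eqmodE => /asboolP.
exact.
Qed.

(** The representative picked from the class equals the polynomial only almost everywhere, so
    integrability of its square is transported along that equality. *)
Lemma poly_class_finite_norm : finite_norm wm 2%:E (poly_class : measurableTypeR R -> R).
Proof.
have pae := poly_class_ae.
have mc : measurable_fun setT (poly_class : measurableTypeR R -> R).
  have h : @measurable_fun _ _ (measurableTypeR R) (measurableTypeR R) setT poly_class.
    exact: measurable_funPT.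
  exact: h.
have i2 : wm.-integrable setT (EFin \o (fun t => (poly_class : measurableTypeR R -> R) t ^+ 2)).
  have := Lfun2_integrableM (Lfun2_poly p) (Lfun2_poly p).
  have mp := measurable_poly p.
  move=> /integrableP[_ h]; apply/integrableP; split.
    by apply/measurable_EFinP; exact: measurable_funX.
  apply: le_lt_trans h; rewrite le_eqVlt; apply/orP; left; apply/eqP.
  apply: ae_eq_integral => //.
  - apply: measurableT_comp => //.
    by apply/measurable_EFinP; exact: measurable_funX.
  - apply: measurableT_comp => //.
    by apply/measurable_EFinP; exact: measurable_funM.
  - by move: pae; apply: filterS => t /= h _; rewrite h.
by have /andP[_] := Lfun2_of_integrable mc i2; rewrite inE.
Qed.

Definition L2w_poly : L2w a :=
  HB.pack poly_class (isFinLebesgue.Build _ _ _ _ _ _ poly_class poly_class_finite_norm).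

Lemma L2w_poly_ae : (L2w_poly : measurableTypeR R -> R) = horner p %[ae wm].
Proof. exact: poly_class_ae. Qed.

End from_poly.

Lemma inner_ae f f' g : measurable_fun setT f -> measurable_fun setT f' ->
  measurable_fun setT g -> f = f' %[ae wm] -> inner a f g = inner a f' g.
Proof.
move=> mf mf' mg ff'; rewrite !innerE// /Rintegral; congr fine.
apply: ae_eq_integral => //.
- by apply/measurable_EFinP; exact: measurable_funM.
- by apply/measurable_EFinP; exact: measurable_funM.
- by move: ff'; apply: filterS => t /= h _; rewrite h.
Qed.

Lemma coef_L2w_poly p k : coef (L2w_poly p) k = moment a (p * ell_poly k).
Proof.
rewrite /coef -inner_poly horner_ell_poly; apply: inner_ae.
- exact: measurable_Lfun (L2w_Lfun _).
- exact: measurable_poly.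
- by rewrite -horner_ell_poly; exact: measurable_poly.
- exact: L2w_poly_ae.
Qed.

Lemma norm2_L2w_poly p q : norm2 a ((L2w_poly p : R -> R) \- (L2w_poly q : R -> R)) =
  Num.sqrt (moment a ((p - q) * (p - q))).
Proof.
have mp r : measurable_fun setT (L2w_poly r : measurableTypeR R -> R).
  exact: measurable_Lfun (L2w_Lfun _).
have mpq := measurable_poly (p - q).
have mLpq := measurable_funB (mp p) (mp q).
have pq : ((L2w_poly p : R -> R) \- (L2w_poly q : R -> R)) = horner (p - q) %[ae wm].
  have := L2w_poly_ae q; have := L2w_poly_ae p; apply: filterS2 => t /= hp hq _.
  by rewrite hp// hq// hornerD hornerN.
rewrite /norm2 -inner_poly; congr Num.sqrt.
rewrite (inner_ae mLpq mpq mLpq pq) innerC.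
by rewrite (inner_ae mLpq mpq mpq pq).
Qed.

Definition L2w_sum n (c : R^nat) : L2w a := L2w_poly (ell_sum n c).

Lemma coef_L2w_sum n c k : coef (L2w_sum n c) k = if (k < n)%N then c k else 0.
Proof. by rewrite coef_L2w_poly moment_ell_sum. Qed.

Lemma norm2_L2w_sum n c d :
  norm2 a ((L2w_sum n c : R -> R) \- (L2w_sum n d : R -> R)) =
  Num.sqrt (\sum_(k < n) (c k - d k) ^+ 2).
Proof.
rewrite norm2_L2w_poly; congr Num.sqrt.
have -> : ell_sum n c - ell_sum n d = ell_sum n (fun k => c k - d k).
  by rewrite /ell_sum -sumrB; apply: eq_bigr => k _; rewrite scalerBl.
exact: moment_ell_sum_sqr.
Qed.

End L2w_theory.

(** * Upper bound *)

Section power_sums.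
Context {R : realType}.
Implicit Types (x sigma rho : R) (k M n : nat).

Lemma ler_powRN (e y z : R) : 0 <= e -> 0 < y -> y <= z -> z `^ (- e) <= y `^ (- e).
Proof.
move=> e0 y0 yz; rewrite !powRN lef_pV2 ?posrE ?powR_gt0 ?(lt_le_trans y0)//.
by rewrite ge0_ler_powR// nnegrE ?(ltW y0)// (le_trans (ltW y0)).
Qed.

(** The loss of a factor 2, from k + 1 <= 2k, avoids distinguishing rho < 1 from rho >= 1. *)
Lemma powR_succ_sub_ge rho k : 0 < rho -> (0 < k)%N ->
  rho / 2 * k%:R `^ (rho - 1) <= k.+1%:R `^ rho - k%:R `^ rho.
Proof.
move=> r0 k0; have k0' : (0 : R) < k%:R by rewrite ltr0n.
have k1' : (0 : R) < k.+1%:R by rewrite ltr0n.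
have -> : k.+1%:R `^ rho = k%:R `^ rho * (k.+1%:R / k%:R) `^ rho.
  by rewrite -powRM ?divr_ge0 ?ler0n// mulrC divfK// gt_eqF.
have h := @powR_ge1D R rho (k.+1%:R / k%:R) (ltW r0) (divr_gt0 k1' k0').
rewrite -[X in _ <= _ - X]mulr1 -mulrBr.
apply: (@le_trans _ _ (k%:R `^ rho * (rho * (1 - (k.+1%:R / k%:R)^-1)))); last first.
  by rewrite ler_wpM2l ?powR_ge0// lerBrDl.
rewrite invf_div powRB; last by rewrite (gt_eqF k0') implybT.
rewrite powRr1 ?ler0n//.
have -> : rho / 2 * (k%:R `^ rho / k%:R) = k%:R `^ rho * (rho * (2 * k%:R)^-1).
  by rewrite invfM; ring.
rewrite ler_wpM2l ?powR_ge0// ler_wpM2l ?(ltW r0)//.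
have -> : 1 - k%:R / k.+1%:R = k.+1%:R^-1 :> R.
  by rewrite -[X in X - _](divff (negbT (gt_eqF k1'))) -mulrBl -natr1 addrAC subrr add0r mul1r.
by rewrite lef_pV2 ?posrE ?mulr_gt0// -natrM ler_nat mul2n -addnn -[k.+1]add1n leq_add2r.
Qed.

Lemma powR_sub_succ_ge sigma k : 0 < sigma -> (0 < k)%N ->
  sigma * k.+1%:R `^ (- (sigma + 1)) <= k%:R `^ (- sigma) - k.+1%:R `^ (- sigma).
Proof.
move=> r0 k0; have k0' : (0 : R) < k%:R by rewrite ltr0n.
have k1' : (0 : R) < k.+1%:R by rewrite ltr0n.
have -> : k%:R `^ (- sigma) = k.+1%:R `^ (- sigma) * (k.+1%:R / k%:R) `^ sigma.
  rewrite powRM ?invr_ge0 ?ler0n// mulrA -powRD ?(gt_eqF k1') ?implybT// addNr powRr0 mul1r.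
  by rewrite -powR_inv1 ?ler0n// -powRrM mulN1r.
have h := @powR_ge1D R sigma (k.+1%:R / k%:R) (ltW r0) (divr_gt0 k1' k0').
rewrite -[X in _ <= _ - X]mulr1 -mulrBr.
apply: (@le_trans _ _ (k.+1%:R `^ (- sigma) * (sigma * (1 - (k.+1%:R / k%:R)^-1)))); last first.
  by rewrite ler_wpM2l ?powR_ge0// lerBrDl.
rewrite invf_div opprD powRD ?(gt_eqF k1') ?implybT// powR_inv1 ?ler0n//.
have -> : 1 - k%:R / k.+1%:R = k.+1%:R^-1 :> R.
  by rewrite -[X in X - _](divff (negbT (gt_eqF k1'))) -mulrBl -natr1 addrAC subrr add0r mul1r.
by rewrite mulrCA.
Qed.

Lemma sum_powR_head rho M : 0 < rho ->
  \sum_(1 <= k < M) k%:R `^ (rho - 1) <= 2 / rho * M%:R `^ rho.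
Proof.
move=> r0; case: M => [|M].
  by rewrite big_geq// powR0 ?mulr0 ?gt_eqF.
rewrite -(@ler_pM2l _ (rho / 2)) ?divr_gt0//.
rewrite [leRHS]mulrA (_ : rho / 2 * (2 / rho) = 1) ?mul1r; last first.
  by field; rewrite gt_eqF.
rewrite mulr_sumr.
apply: (@le_trans _ _ (\sum_(1 <= k < M.+1) (k.+1%:R `^ rho - k%:R `^ rho))).
  rewrite big_nat [leRHS]big_nat ler_sum// => k /andP[k1 _].
  exact: powR_succ_sub_ge.
rewrite telescope_sumr// lerBlDr lerDl.
by rewrite powR_ge0.
Qed.

(** The term at k + 1 is compared with the difference of powers at k and k + 1, so the first term is
    left out of the telescoping sum; it is the 1 in the constant. *)
Lemma sum_powR_tail sigma M n : 0 < sigma -> (0 < M)%N ->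
  \sum_(M <= k < n) k%:R `^ (- (sigma + 1)) <= (1 + sigma^-1) * M%:R `^ (- sigma) :> R.
Proof.
move=> r0 M0; have M0' : (0 : R) < M%:R by rewrite ltr0n.
have s0 : 0 <= (1 + sigma^-1) * M%:R `^ (- sigma).
  by rewrite mulr_ge0 ?powR_ge0// addr_ge0// invr_ge0 ltW.
have [nM|Mn] := leqP n M; first by rewrite big_geq.
rewrite big_ltn// mulrDl mul1r lerD//.
  by rewrite ler_powR// ?ler1n//; lra.
case: n Mn => // n; rewrite ltnS => Mn.
rewrite big_add1/= mulrC ler_pdivlMr// mulrC mulr_sumr.
apply: (@le_trans _ _ (\sum_(M <= k < n) (k%:R `^ (- sigma) - k.+1%:R `^ (- sigma)))).
  rewrite big_nat [leRHS]big_nat ler_sum// => k /andP[Mk _].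
  by apply: powR_sub_succ_ge => //; exact: leq_trans Mk.
rewrite -[leLHS]opprK -sumrN.
under eq_bigr do rewrite opprB.
by rewrite telescope_sumr// opprB lerBlDr lerDl powR_ge0.
Qed.

(* Splits [x] according to whether it exceeds the threshold [l]. *)
Lemma le_threshold (l x r : R) : 0 < l -> 0 <= x -> 1 <= r ->
  x <= l + l `^ (1 - r) * x `^ r.
Proof.
move=> l0 x0 r1; have [xl|lx] := leP x l.
  by rewrite (le_trans xl)// lerDl mulr_ge0// powR_ge0.
rewrite (@le_trans _ _ (l `^ (1 - r) * x `^ r))//; last by rewrite lerDr ltW.
have x0' : 0 < x by exact: lt_trans lx.
have -> : l `^ (1 - r) * x `^ r = x * (x / l) `^ (r - 1).
  rewrite powRM ?invr_ge0 ?(ltW l0) ?(ltW x0')//.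
  rewrite -powR_inv1 ?(ltW l0)// -powRrM mulN1r opprB.
  by rewrite -(mulr_powRB1 x0 (lt_le_trans ltr01 r1)); ring.
rewrite ler_peMr// -[leLHS](powRr0 (x / l)) ler_powR ?subr_ge0//.
by rewrite ler_pdivlMr// mul1r ltW.
Qed.

End power_sums.

Definition decay {R : realType} (s : \bar R) (mu : R) : R := mu + sinv s - 1.

(** * Splitting the coefficients of a function in the class *)

Section smoothness_class.
Context {R : realType}.
Variables (a mu : R) (s : \bar R).
Hypothesis s1 : (1 <= s)%E.
Local Notation sigma := (decay s mu).

(** For finite s = r, e_k is the k-th term of the series bounded by the class. Applying
    [le_threshold] at the critical size k^(-(mu + 1/r)) leaves the factor k^(-sigma), as (mu +
    1/r)(r - 1) - r mu = -sigma. For infinite s, sigma + 1 = mu and e = 0 suffices. *)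
Lemma W_coef_decomp (f : L2w a) : W s mu f ->
  exists2 e : R^nat, (forall k, 0 <= e k) /\ (forall n, \sum_(k < n) e k <= 1) &
    forall k, `|coef f k| <= (maxn 1 k)%:R `^ (- (sigma + 1)) +
                             (maxn 1 k)%:R `^ (- sigma) * e k.
Proof.
rewrite /W/= /smooth_norm /decay /sinv; move: s1; case: s => [r|_|//]; last first.
  move=> h; exists (fun=> 0); first by split => // n; rewrite big1.
  move=> k; have u0 : (0 : R) < (maxn 1 k)%:R by rewrite ltr0n leq_max.
  have : (((maxn 1 k)%:R `^ mu * `|coef f k|)%:E <= 1)%E.
    by apply: le_trans h; apply: ereal_sup_ubound; exists k.
  rewrite lee_fin mulr0 addr0 invey/= addr0 subrK powRN => h1.
  by rewrite -[leRHS]mul1r ler_pdivlMr ?powR_gt0// mulrC.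
rewrite lee_fin => r1; have r0 : 0 < r by exact: lt_le_trans r1.
have rn0 : r != 0 by rewrite gt_eqF.
rewrite inver (negbTE rn0)/= => h.
pose e k := (maxn 1 k)%:R `^ (r * mu) * `|coef f k| `^ r.
have e0 k : 0 <= e k by rewrite mulr_ge0 ?powR_ge0.
have sume n : \sum_(k < n) e k <= 1.
  rewrite -lee_fin -sumEFin.
  apply: (@le_trans _ _ (\sum_(0 <= k <oo) (e k)%:E)%E).
    rewrite -(big_mkord xpredT (fun k => (e k)%:E)).
    by apply: nneseries_lim_ge => k _ _; rewrite lee_fin.
  have s0 : (0 <= \sum_(0 <= k <oo) (e k)%:E)%E.
    by apply: nneseries_ge0 => k _ _; rewrite lee_fin.
  have := @gt0_ler_poweR R r (ltW r0) _ _ _ _ h.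
  rewrite -poweRrM mulVf// poweRe1// poweR1r; apply.
    by rewrite in_itv/= poweR_ge0 leey.
  by rewrite in_itv/= lee_fin ler01 leey.
exists e; first by split.
move=> k; set u : R := (maxn 1 k)%:R.
have u0 : 0 < u by rewrite ltr0n leq_max.
have := @le_threshold R (u `^ (- (mu + r^-1))) `|coef f k| r (powR_gt0 _ u0) (normr_ge0 _) r1.
move=> /le_trans; apply.
have -> : mu + r^-1 - 1 + 1 = mu + r^-1 by rewrite subrK.
rewrite lerD2l /e -/u mulrA ler_wpM2r ?powR_ge0//.
rewrite -powRrM -powRD ?(gt_eqF u0) ?implybT//.
rewrite le_eqVlt; apply/orP; left; apply/eqP; congr (_ `^ _).
by field.
Qed.

End smoothness_class.

Section coefficient_sums.
Context {R : realType}.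
Variables (sigma : R) (x e : R^nat).
Hypothesis s0 : 0 < sigma.
Hypothesis e0 : forall k, 0 <= e k.
Hypothesis e1 : forall n, \sum_(k < n) e k <= 1.
Hypothesis xe : forall k, `|x k| <= (maxn 1 k)%:R `^ (- (sigma + 1)) +
                             (maxn 1 k)%:R `^ (- sigma) * e k.

Let xe' k : (0 < k)%N -> `|x k| <= k%:R `^ (- (sigma + 1)) + k%:R `^ (- sigma) * e k.
Proof. by move=> k0; have := xe k; rewrite (maxn_idPr k0). Qed.

Lemma sum_e_le M n : \sum_(M <= k < n) e k <= 1.
Proof.
apply: le_trans (e1 n).
have [nM|Mn] := leqP n M; first by rewrite big_geq// sumr_ge0.
rewrite -(big_mkord xpredT e) (big_cat_nat (leq0n M) (ltnW Mn))/= lerDr.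
by rewrite sumr_ge0.
Qed.

Lemma coef_tail_le M n : (0 < M)%N ->
  \sum_(M <= k < n) `|x k| <= (2 + sigma^-1) * M%:R `^ (- sigma).
Proof.
move=> M0; have M0' : (0 : R) < M%:R by rewrite ltr0n.
apply: (@le_trans _ _ (\sum_(M <= k < n) (k%:R `^ (- (sigma + 1)) + M%:R `^ (- sigma) * e k))).
  rewrite big_nat [leRHS]big_nat ler_sum// => k /andP[Mk _].
  have k0 : (0 < k)%N by exact: leq_trans Mk.
  rewrite (le_trans (xe' k0))// lerD2l ler_wpM2r// !powRN.
  rewrite lef_pV2 ?posrE ?powR_gt0 ?ltr0n//.
  by rewrite ge0_ler_powR ?nnegrE ?ler0n ?ler_nat// ltW.
rewrite big_split/= -mulr_sumr.
have h1 := sum_powR_tail n s0 M0.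
have h2 := ler_wpM2l (powR_ge0 M%:R (- sigma)) (sum_e_le M n).
lra.
Qed.

(** The cost of damping. The condition theta > sigma makes the exponent theta - sigma positive, so
    the sum of k^(theta - sigma - 1) has the order of M^(theta - sigma), and the e_k are weighted by
    at most that power. *)
Lemma coef_head_le theta M (N : R) : sigma < theta -> 0 < N ->
  \sum_(k < M) (k%:R / N) `^ theta * `|x k| <=
  (2 / (theta - sigma) + 1) * N `^ (- theta) * M%:R `^ (theta - sigma).
Proof.
move=> st N0; have t0 : 0 < theta by exact: lt_trans st.
have rho0 : 0 < theta - sigma by rewrite subr_gt0.
case: M => [|M].
  by rewrite big_ord0 powR0 ?mulr0// gt_eqF.
(* The term k = 0 is split off: it vanishes since 0^theta = 0, and the power bounds hold only for k
   >= 1. *)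
rewrite -(big_mkord xpredT (fun k => (k%:R / N) `^ theta * `|x k|)) big_ltn//.
rewrite mul0r powR0 ?gt_eqF// mul0r add0r.
apply: (@le_trans _ _ (\sum_(1 <= k < M.+1) N `^ (- theta) *
   (k%:R `^ (theta - sigma - 1) + M.+1%:R `^ (theta - sigma) * e k))).
  rewrite big_nat [leRHS]big_nat ler_sum// => k /andP[k0 kM].
  have k0' : (0 : R) < k%:R by rewrite ltr0n.
  rewrite powRM ?ler0n ?invr_ge0 ?(ltW N0)// -powR_inv1 ?(ltW N0)// -powRrM mulN1r.
  rewrite mulrAC [leLHS]mulrC ler_wpM2l ?powR_ge0//.
  rewrite (le_trans (ler_wpM2l (powR_ge0 _ _) (xe' k0)))//.
  rewrite mulrDr mulrA -!powRD ?(gt_eqF k0') ?implybT//.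
  rewrite lerD ?ler_wpM2r//.
    by rewrite le_eqVlt; apply/orP; left; apply/eqP; congr (_ `^ _); ring.
  by rewrite ge0_ler_powR ?nnegrE ?ler0n ?ler_nat ?(ltW rho0)// ltnW.
rewrite -mulr_sumr big_split/= -mulr_sumr [leRHS]mulrAC [leRHS]mulrC ler_wpM2l ?powR_ge0//.
rewrite mulrDl mul1r lerD//; first exact: sum_powR_head.
by rewrite ler_piMr ?powR_ge0// sum_e_le.
Qed.

End coefficient_sums.

(** * Error of a linear summation method *)

Section recovery_error.
Context {R : realType}.

(** With x the exact and y the noisy coefficients, x - nu y = (1 - nu) x + nu (x - y) separates
    damping from noise, and T bounds the tail. *)
Lemma series_error (x y b nu : R^nat) (B T : R) (M : nat) :
  (forall k, `|b k| <= B) -> (forall n, \sum_(M <= k < n) `|x k| <= T) ->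
  `|limn (series (fun k => x k * b k)) - \sum_(k < M) nu k * y k * b k| <=
  B * (\sum_(k < M) `|1 - nu k| * `|x k| + \sum_(k < M) `|nu k| * `|y k - x k| + T).
Proof.
move=> bB xT; have B0 : 0 <= B by exact: le_trans (normr_ge0 _) (bB 0%N).
pose u := series (fun k => x k * b k).
have T0 : 0 <= T by apply: le_trans (xT M); rewrite big_geq.
(* Absolute convergence is secured first: without convergence, [limn] would carry no information. *)
have partial n : \sum_(0 <= k < n) `|x k * b k| <= B * (\sum_(k < M) `|x k| + T).
  apply: (@le_trans _ _ (\sum_(0 <= k < n) B * `|x k|)).
    by apply: ler_sum => k _; rewrite normrM mulrC ler_wpM2r.
  rewrite -mulr_sumr ler_wpM2l// -(big_mkord xpredT (fun k => `|x k|)).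
  have [nM|/ltnW Mn] := leqP n M.
    rewrite (big_cat_nat (leq0n n) nM)/= -addrA lerDl addr_ge0//.
    exact: sumr_ge0.
  by rewrite (big_cat_nat (leq0n M) Mn)/= lerD2l.
have cu : cvgn u.
  apply: normed_cvg.
  rewrite -[X in cvgn X]/(fun n => \sum_(0 <= k < n) `|x k * b k|).
  apply: nondecreasing_is_cvgn.
    by apply/nondecreasing_seqP => n; rewrite big_nat_recr//= lerDl.
  exists (B * (\sum_(k < M) `|x k| + T)) => _ [n _ <-].
  exact: partial.
set S := \sum_(k < M) nu k * y k * b k.
have nu_cvg : `|u n - S| @[n --> \oo] --> `|limn u - S|.
  by apply: cvg_norm; apply: cvgB => //; exact: cvg_cst.
rewrite -(cvg_lim _ nu_cvg)//; apply: limr_le; first exact: (cvgP _ nu_cvg).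
near=> n.
have Mn : (M <= n)%N by near: n; exact: nbhs_infty_ge.
have -> : u n - S = \sum_(k < M) ((1 - nu k) * x k + nu k * (x k - y k)) * b k
    + \sum_(M <= k < n) x k * b k.
  rewrite /u /series/= (big_cat_nat (leq0n M) Mn)/= addrAC; congr (_ + _).
  rewrite big_mkord /S -sumrB; apply: eq_bigr => k _; ring.
rewrite (le_trans (ler_normD _ _))// mulrDr lerD//; last first.
  rewrite (le_trans (ler_norm_sum _ _ _))//.
  apply: (@le_trans _ _ (\sum_(M <= k < n) B * `|x k|)).
    by apply: ler_sum => k _; rewrite normrM mulrC ler_wpM2r.
  by rewrite -mulr_sumr ler_wpM2l.
rewrite -big_split/= mulr_sumr (le_trans (ler_norm_sum _ _ _))//.
apply: ler_sum => k _; rewrite normrM mulrC ler_pM//.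
rewrite (le_trans (ler_normD _ _))// !normrM lerD// ler_wpM2l//.
by rewrite distrC.
Unshelve. all: by end_near. Qed.

Lemma nneseries_leP (F : R^nat) (C : R) : (forall k, 0 <= F k) ->
  (\sum_(0 <= k <oo) (F k)%:E <= C%:E)%E <-> (forall n, \sum_(k < n) F k <= C).
Proof.
move=> F0; have F0' k : (0%nat <= k)%N -> xpredT k -> (0 <= (F k)%:E)%E.
  by move=> _ _; rewrite lee_fin.
split=> [h n|h].
  rewrite -lee_fin -sumEFin -(big_mkord xpredT (fun k => (F k)%:E)).
  by apply: le_trans h; exact: nneseries_lim_ge.
apply: lime_le; first exact: is_cvg_nneseries.
by near=> n; rewrite sumEFin lee_fin big_mkord.
Unshelve. all: by end_near. Qed.

Lemma poweR_leP (z : \bar R) (r C : R) : (0 <= z)%E -> 0 < r -> 0 <= C ->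
  (z `^ r^-1 <= C%:E)%E <-> (z <= (C `^ r)%:E)%E.
Proof.
move=> z0 r0 C0; have rV0 : 0 <= r^-1 by rewrite invr_ge0 ltW.
have I (w : \bar R) : (0 <= w)%E -> w \in `[0%E, +oo%E].
  by move=> w0; rewrite in_itv/= w0 leey.
split=> h.
  have := gt0_ler_poweR (ltW r0) (I _ (poweR_ge0 _ _)) (I C%:E _) h.
  by rewrite -poweRrM mulVf ?gt_eqF// poweRe1// => ->.
have := gt0_ler_poweR rV0 (I _ z0) (I _ _) h.
by rewrite poweR_EFin -powRrM mulfV ?gt_eqF// powRr1// => ->//; rewrite lee_fin powR_ge0.
Qed.

Lemma ell2_norm_leP (x : R^nat) (d : R) : 0 <= d ->
  (ell2_norm x <= d%:E)%E <-> (forall n, \sum_(k < n) x k ^+ 2 <= d ^+ 2).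
Proof.
move=> d0; rewrite /ell2_norm poweR_leP//.
  by rewrite powR_mulrn//; apply: nneseries_leP => k; exact: sqr_ge0.
by apply: nneseries_ge0 => k _ _; rewrite lee_fin sqr_ge0.
Qed.

Lemma sum_norm_le_sqrt (x : R^nat) (d : R) M : 0 < d ->
  \sum_(k < M) x k ^+ 2 <= d ^+ 2 -> \sum_(k < M) `|x k| <= d * Num.sqrt M%:R.
Proof.
move=> d0; have [->|M0] := posnP M; first by rewrite !big_ord0 sqrtr0 mulr0.
move=> h; set q := Num.sqrt M%:R.
have q0 : 0 < q by rewrite sqrtr_gt0 ltr0n.
have qq : q ^+ 2 = M%:R by rewrite sqr_sqrtr.
(* This weight balances |x| <= l/2 + x^2/(2l): after summation each half contributes at most d
   sqrt(M)/2. *)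
pose l := d / q.
have l0 : 0 < l by rewrite divr_gt0.
have l20 : 0 < 2 * l by rewrite mulr_gt0.
have step k : `|x k| <= l / 2 + x k ^+ 2 / (2 * l).
  have h1 := sqr_ge0 (`|x k| - l).
  have h2 : `|x k| * (2 * l) <= (l / 2 + x k ^+ 2 / (2 * l)) * (2 * l).
    rewrite [leRHS]mulrDl divfK ?(gt_eqF l20)//.
    rewrite -[x k ^+ 2]real_normK ?num_real//; nra.
  by rewrite -(ler_pM2r l20).
apply: (le_trans (ler_sum _ (fun (k : 'I_M) _ => step k))).
rewrite big_split/= sumr_const card_ord -mulr_suml.
have : (\sum_(k < M) x k ^+ 2) / (2 * l) <= d ^+ 2 / (2 * l).
  by rewrite ler_wpM2r// invr_ge0 mulr_ge0// ltW.
have -> : d ^+ 2 / (2 * l) = d * q / 2.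
  by rewrite /l; field; rewrite !gt_eqF.
have -> : (l / 2) *+ M = d * q / 2.
  by rewrite -mulr_natr -qq /l; field; rewrite gt_eqF.
lra.
Qed.

Variables (a mu : R) (s : \bar R).
Hypothesis a0 : 0 <= a.
Hypothesis s1 : (1 <= s)%E.
Local Notation sigma := (decay s mu).
Hypothesis sigma0 : 0 < sigma.

(** Covers plain truncation, with all multipliers 1, and [summation], with M = N + 1 terms. *)
Definition partial_sum (nu : R^nat) (M : nat) (f : L2w a) (t : R) : R :=
  \sum_(k < M) nu k * coef f k * ell a k t.

(** The number of terms M and the scale N of the multipliers are kept apart because [summation] uses
    N + 1 terms. The condition M <= 2N bounds the multipliers by 1 + Cnu 2^theta. *)
Lemma errC_le (f fd : L2w a) (nu : R^nat) (M : nat) (theta Cnu N d : R) :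
  W s mu f -> (0 < M)%N -> 0 < N -> M%:R <= 2 * N -> 0 < d -> sigma < theta -> 0 <= Cnu ->
  (forall k, (k < M)%N -> `|1 - nu k| <= Cnu * (k%:R / N) `^ theta) ->
  \sum_(k < M) (coef fd k - coef f k) ^+ 2 <= d ^+ 2 ->
  (errC f (partial_sum nu M fd) <=
  (Num.sqrt (lag_const a) *
    (Cnu * ((2 / (theta - sigma) + 1) * N `^ (- theta) * M%:R `^ (theta - sigma))
     + (1 + Cnu * 2 `^ theta) * (d * Num.sqrt M%:R)
     + (2 + sigma^-1) * M%:R `^ (- sigma)))%:E)%E.
Proof.
move=> Wf M0 N0 MN d0 st Cnu0 hnu hd.
have [e [e0 e1] xe] := W_coef_decomp s1 Wf.
have t0 : 0 < theta by exact: lt_trans st.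
apply: ge_ereal_sup => z [t /=]; rewrite in_itv/= andbT => t_gt0 <-{z}.
rewrite lee_fin.
pose b k := ell a k t * Num.sqrt (weight a t).
have bB k : `|b k| <= Num.sqrt (lag_const a) by exact: norm_ell_weight_le.
have xT n : \sum_(M <= k < n) `|coef f k| <= (2 + sigma^-1) * M%:R `^ (- sigma).
  exact: coef_tail_le.
have := series_error (coef fd) nu bB xT.
have -> : limn (series (fun k => coef f k * b k)) = wrep f t.
  by rewrite /wrep; congr (limn (series _)); apply/funext => k; rewrite mulrA.
have -> : \sum_(k < M) nu k * coef fd k * b k =
    partial_sum nu M fd t * Num.sqrt (weight a t).
  by rewrite mulr_suml; apply: eq_bigr => k _; rewrite mulrA.
move=> /le_trans; apply; rewrite ler_wpM2l// lerD2r lerD//.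
  apply: (@le_trans _ _ (Cnu * \sum_(k < M) (k%:R / N) `^ theta * `|coef f k|)).
    rewrite mulr_sumr; apply: ler_sum => k _; rewrite mulrA ler_wpM2r//.
    exact: hnu.
  by rewrite ler_wpM2l//; apply: (@coef_head_le _ sigma (coef f) e).
have nu1 k : (k < M)%N -> `|nu k| <= 1 + Cnu * 2 `^ theta.
  move=> kM; rewrite -[nu k](subKr 1) (le_trans (ler_normB _ _))// normr1 lerD2l.
  rewrite (le_trans (hnu k kM))// ler_wpM2l//.
  rewrite ge0_ler_powR// ?nnegrE ?(ltW t0) ?divr_ge0 ?(ltW N0)//.
  rewrite ler_pdivrMr// (le_trans _ MN)// ler_nat; exact: ltnW.
apply: (@le_trans _ _ (\sum_(k < M) (1 + Cnu * 2 `^ theta) * `|coef fd k - coef f k|)).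
  by apply: ler_sum => k _; rewrite ler_wpM2r// nu1.
rewrite -mulr_sumr ler_wpM2l ?addr_ge0 ?mulr_ge0 ?powR_ge0//.
exact: (@sum_norm_le_sqrt (fun k => coef fd k - coef f k)).
Qed.

(** With M and N of order X and noise X^(-(sigma + 1/2)), damping gives the exponent -theta + (theta
    - sigma), noise -(sigma + 1/2) + 1/2 and the tail -sigma, all equal. *)
Lemma errC_le_rate (theta Cnu l u : R) : sigma < theta -> 0 <= Cnu -> 0 < l -> l <= u ->
  exists2 c : R, 0 < c & forall (X : R) (N M : nat) (nu : R^nat) (f fd : L2w a),
    1 <= X -> (0 < N)%N -> (0 < M)%N -> (M <= 2 * N)%N ->
    l * X <= N%:R <= u * X -> l * X <= M%:R <= u * X ->
    (forall k, (k < M)%N -> `|1 - nu k| <= Cnu * (k%:R / N%:R) `^ theta) ->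
    W s mu f ->
    \sum_(k < M) (coef fd k - coef f k) ^+ 2 <= (X `^ (- (sigma + 2^-1))) ^+ 2 ->
    (errC f (partial_sum nu M fd) <=
      (c * X `^ (- sigma))%:E)%E.
Proof.
move=> st Cnu0 l0 lu; have u0 : 0 < u by exact: lt_le_trans lu.
have t0 : 0 < theta by exact: lt_trans st.
have rho0 : 0 < theta - sigma by rewrite subr_gt0.
pose A := Cnu * ((2 / (theta - sigma) + 1) * (l `^ (- theta) * u `^ (theta - sigma))).
pose B := (1 + Cnu * 2 `^ theta) * Num.sqrt u.
pose D := (2 + sigma^-1) * l `^ (- sigma).
have A0 : 0 <= A.
  by rewrite !mulr_ge0 ?powR_ge0// addr_ge0// divr_ge0// ltW.
have B0 : 0 <= B by rewrite mulr_ge0 ?sqrtr_ge0// addr_ge0// mulr_ge0 ?powR_ge0.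
have D0 : 0 <= D by rewrite mulr_ge0 ?powR_ge0// addr_ge0// invr_ge0 ltW.
exists (Num.sqrt (lag_const a) * (A + B + D) + 1).
  by rewrite ltr_wpDl// mulr_ge0 ?sqrtr_ge0// !addr_ge0.
move=> X N M nu f fd X1 N0 M0 MN /andP[lN Nu] /andP[lM Mu] hnu Wf hd.
have X0 : 0 < X by exact: lt_le_trans X1.
have N0' : (0 : R) < N%:R by rewrite ltr0n.
have M0' : (0 : R) < M%:R by rewrite ltr0n.
have MN' : M%:R <= 2 * N%:R :> R by rewrite -natrM ler_nat.
have d0 : 0 < X `^ (- (sigma + 2^-1)) by rewrite powR_gt0.
apply: le_trans (errC_le Wf M0 N0' MN' d0 st Cnu0 hnu hd) _.
rewrite lee_fin [leRHS]mulrDl mul1r -[leLHS]addr0 lerD ?powR_ge0// -[leRHS]mulrA.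
rewrite ler_wpM2l ?sqrtr_ge0//.
rewrite [leRHS]mulrDl [X in _ <= X + _]mulrDl.
have lX0 : 0 < l * X by rewrite mulr_gt0.
have uX0 : 0 < u * X by rewrite mulr_gt0.
rewrite !lerD//.
- rewrite /A -!mulrA ler_wpM2l// ler_wpM2l ?addr_ge0// ?divr_ge0 ?(ltW rho0)//.
  apply: (@le_trans _ _ ((l * X) `^ (- theta) * (u * X) `^ (theta - sigma))).
    apply: (ler_pM (powR_ge0 _ _) (powR_ge0 _ _) (ler_powRN (ltW t0) lX0 lN)).
    by rewrite ge0_ler_powR ?nnegrE ?(ltW rho0) ?ler0n ?(ltW uX0).
  rewrite !powRM ?(ltW l0) ?(ltW u0) ?(ltW X0)// mulrACA.
  by rewrite -powRD ?(gt_eqF X0) ?implybT// addKr -mulrA.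
- rewrite /B -mulrA ler_wpM2l ?addr_ge0 ?mulr_ge0 ?powR_ge0//.
  have -> : X `^ (- sigma) = X `^ (- (sigma + 2^-1)) * Num.sqrt X.
    rewrite -powR12_sqrt ?(ltW X0)// -powRD ?(gt_eqF X0) ?implybT//.
    by congr (_ `^ _); field.
  rewrite mulrCA ler_wpM2l ?powR_ge0// -sqrtrM ?(ltW u0)//.
  by rewrite ler_sqrt// ltW.
- rewrite /D -[leRHS]mulrA ler_wpM2l ?addr_ge0 ?invr_ge0 ?(ltW sigma0)//.
  rewrite -powRM ?(ltW l0) ?(ltW X0)//.
  by rewrite ler_powRN// ltW.
Qed.

End recovery_error.

(** * Lower bound *)

Section lower_bound.
Context {R : realType}.
Variables (a mu : R) (s : \bar R).
Hypothesis a0 : 0 <= a.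
Hypothesis s1 : (1 <= s)%E.
Hypothesis mu0 : 0 < mu.
Local Notation sigma := (decay s mu).
Hypothesis sigma0 : 0 < sigma.

(** Equal to (2M)^(-mu) M^(-1/s): the smoothness weight is at most (2M)^mu on the block, and M equal
    entries cost M^(1/s). *)
Definition block_height (M : nat) : R := 2 `^ (- mu) * M%:R `^ (- (sigma + 1)).

Definition block (M : nat) : R^nat :=
  fun k => if (M <= k < 2 * M)%N then block_height M else 0.

Lemma block_height_ge0 M : 0 <= block_height M.
Proof. by rewrite mulr_ge0// powR_ge0. Qed.

Lemma sum_block_eq (v : R) M :
  \sum_(k < 2 * M) (if (M <= k < 2 * M)%N then v else 0) = M%:R * v.
Proof.
pose g k := if (M <= k < 2 * M)%N then v else 0.
have M2 : (M <= 2 * M)%N by rewrite leq_pmull.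
rewrite -(big_mkord xpredT g) (big_cat_nat (leq0n M) M2)/=.
have -> : \sum_(0 <= k < M) g k = 0.
  by rewrite big_nat big1// => k /andP[_ kM]; rewrite /g leqNgt kM.
rewrite add0r big_nat (eq_bigr (fun=> v)); last by move=> k kM; rewrite /g kM.
by rewrite -big_nat sumr_const_nat mul2n -addnn addnK mulr_natl.
Qed.

Lemma sum_block (v : R) M n : 0 <= v ->
  \sum_(k < n) (if (M <= k < 2 * M)%N then v else 0) <= M%:R * v.
Proof.
move=> v0; pose g k := if (M <= k < 2 * M)%N then v else 0.
have g0 k : 0 <= g k by rewrite /g; case: ifP.
rewrite -(sum_block_eq v M) -!(big_mkord xpredT g).
apply: (@le_trans _ _ (\sum_(0 <= k < 2 * M + n) g k)).
  by rewrite [leRHS](big_cat_nat (leq0n n) (leq_addl _ _))/= lerDl sumr_ge0.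
rewrite (big_cat_nat (leq0n (2 * M)) (leq_addr _ _))/=.
have -> : \sum_(2 * M <= k < 2 * M + n) g k = 0.
  by rewrite big_nat big1// => k /andP[Mk _]; rewrite /g (ltnNge k) Mk andbF.
by rewrite addr0.
Qed.

(** Only absolute values are prescribed, so that the block function and its opposite are covered
    together. *)
Lemma W_block (f : L2w a) M : (0 < M)%N -> (forall k, `|coef f k| = block M k) ->
  W s mu f.
Proof.
move=> M0 fM; have M0' : (0 : R) < M%:R by rewrite ltr0n.
have M2 : (0 : R) < 2 * M%:R by rewrite mulr_gt0.
rewrite /W/= /smooth_norm; move: s1 fM.
rewrite /block /block_height /decay /sinv; case: s => [r|_|//]; last first.
  move=> fM; apply: ge_ereal_sup => z [k _ <-{z}]; rewrite lee_fin fM.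
  case: ifPn => [/andP[Mk kM]|_]; last by rewrite mulr0.
  rewrite invey/= addr0 subrK (maxn_idPr (leq_trans M0 Mk)).
  rewrite -powRM// powRN ler_pdivrMr ?powR_gt0// mul1r.
  by rewrite ge0_ler_powR ?nnegrE ?(ltW mu0) ?(ltW M2)// -natrM ler_nat ltnW.
have n2 : (2 : R) != 0 by [].
have nM : (M%:R : R) != 0 by rewrite gt_eqF.
rewrite lee_fin => r1 fM; have r0 : 0 < r by exact: lt_le_trans r1.
have rn0 : r != 0 by rewrite gt_eqF.
apply/poweR_leP => //.
  by apply: nneseries_ge0 => k _ _; rewrite lee_fin mulr_ge0 ?powR_ge0.
rewrite powR1; apply/nneseries_leP => [k|n]; first by rewrite mulr_ge0 ?powR_ge0.
apply: (@le_trans _ _ (\sum_(k < n) (if (M <= k < 2 * M)%N then M%:R^-1 else 0))).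
  apply: ler_sum => k _; rewrite fM.
  case: ifPn => [/andP[Mk kM]|_]; last by rewrite powR0// mulr0.
  rewrite inver (negbTE rn0)/= (maxn_idPr (leq_trans M0 Mk)).
  have kM' : k%:R `^ (r * mu) <= (2 * M%:R) `^ (r * mu).
    rewrite ge0_ler_powR ?nnegrE ?(ltW M2)//.
      by rewrite mulr_ge0 ?(ltW r0) ?(ltW mu0).
    by rewrite -natrM ler_nat ltnW.
  apply: (le_trans (ler_wpM2r (powR_ge0 _ _) kM')).
  rewrite !powRM ?powR_ge0// -!powRrM mulrACA -!powRD ?n2 ?nM ?implybT//.
  rewrite (_ : r * mu + - mu * r = 0); last by ring.
  rewrite powRr0 mul1r -[leRHS]powR_inv1 ?ler0n// le_eqVlt; apply/orP; left; apply/eqP.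
  by congr (_ `^ _); field.
have := @sum_block M%:R^-1 M n; rewrite invr_ge0 ler0n => /(_ isT).
by rewrite divff// gt_eqF.
Qed.

Lemma wrep_L2w_sum n (c : R^nat) t :
  wrep (L2w_sum a0 n c) t = \sum_(k < n) c k * (ell a k t * Num.sqrt (weight a t)).
Proof.
rewrite /wrep; apply: cvg_lim => //; apply: cvg_near_cst; near=> m.
have nm : (n <= m)%N by near: m; exact: nbhs_infty_ge.
rewrite /series/= (big_cat_nat (leq0n n) nm)/=.
have -> : \sum_(n <= k < m) coef (L2w_sum a0 n c) k * ell a k t
    * Num.sqrt (weight a t) = 0.
  by rewrite big_nat big1// => k /andP[nk _]; rewrite coef_L2w_sum ltnNge nk !mul0r.
by rewrite addr0 big_mkord; apply: eq_bigr => k _; rewrite coef_L2w_sum ltn_ord mulrA.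
Unshelve. all: by end_near. Qed.

Definition ell_low : R :=
  Num.sqrt (Gamma (a + 1) * (6 * (a + 1)) `^ (- a) * expR (-1)) / (2 * Gamma (a + 1)).

Lemma ell_low_gt0 : 0 < ell_low.
Proof.
have G0 := Gamma_gt0 a0.
have a1 : 0 < 6 * (a + 1) by rewrite mulr_gt0// ltr_wpDl.
by rewrite divr_gt0 ?mulr_gt0// sqrtr_gt0 !mulr_gt0 ?powR_gt0 ?expR_gt0.
Qed.

(** The point 1/(6M) keeps k t <= 1/3 on the whole block, as [lag_ge] requires. The growth M^a of
    the norm cancels against t^a = (6M)^(-a), which leaves the constant [ell_low] free of M. *)
Lemma ell_weight_ge M k : (0 < M)%N -> (M <= k < 2 * M)%N ->
  ell_low <= ell a k (6 * M%:R)^-1 * Num.sqrt (weight a (6 * M%:R)^-1).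
Proof.
move=> M0 /andP[Mk kM]; set t := (6 * M%:R)^-1.
have G0 := Gamma_gt0 a0.
have M0' : (0 : R) < M%:R by rewrite ltr0n.
have M1 : (1 : R) <= M%:R by rewrite ler1n.
have a1 : 0 < a + 1 by rewrite ltr_wpDl.
have a6 : 0 < 6 * (a + 1) by rewrite mulr_gt0.
have t0 : 0 < t by rewrite invr_gt0 mulr_gt0.
have r0 := lag_norm_gt0 k a0.
have kt : k%:R * t <= 3^-1.
  rewrite /t ler_pdivrMr ?mulr_gt0//.
  have : k%:R <= 2 * M%:R :> R by rewrite -natrM ler_nat ltnW.
  lra.
have L := lag_ge a0 t0 kt.
have rw : Gamma (a + 1) * (6 * (a + 1)) `^ (- a) * expR (-1) <= lag_norm a k * weight a t.
  have h1 := lag_norm_ge k a0.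
  have h2 : ((M%:R) / (a + 1)) `^ a <= ((k%:R + a + 1) / (a + 1)) `^ a.
    rewrite ge0_ler_powR// ?nnegrE ?divr_ge0 ?addr_ge0 ?(ltW a1)//.
    rewrite ler_pM2r ?invr_gt0// -addrA (le_trans (_ : _ <= k%:R))// ?ler_nat//.
    by rewrite lerDl ltW.
  have h3 : expR (-1) <= expR (- t).
    by rewrite ler_expR lerN2 /t invf_le1 ?mulr_gt0//; lra.
  have -> : (6 * (a + 1)) `^ (- a) = (M%:R / (a + 1)) `^ a * t `^ a.
    rewrite -powRM ?divr_ge0 ?(ltW a1) ?(ltW t0)//.
    have -> : M%:R / (a + 1) * t = (6 * (a + 1))^-1.
      by rewrite /t; field; rewrite !gt_eqF.
    by rewrite -powR_inv1 ?(ltW a6)// -powRrM mulN1r.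
  rewrite /weight.
  have G1 : Gamma (a + 1) * (M%:R / (a + 1)) `^ a <= lag_norm a k.
    by apply: le_trans h1; rewrite ler_pM2l.
  rewrite mulrA -mulrA ler_pM// ?mulr_ge0 ?powR_ge0 ?expR_ge0 ?(ltW G0)//.
  by rewrite ler_pM2l ?powR_gt0.
rewrite ellE.
apply: (@le_trans _ _ (Num.sqrt (lag_norm a k)^-1 * (lag_norm a k / Gamma (a + 1) / 2)
    * Num.sqrt (weight a t))); last first.
  by rewrite ler_wpM2r ?sqrtr_ge0// ler_wpM2l ?sqrtr_ge0.
have -> : Num.sqrt (lag_norm a k)^-1 * (lag_norm a k / Gamma (a + 1) / 2)
    * Num.sqrt (weight a t) = Num.sqrt (lag_norm a k * weight a t) / (2 * Gamma (a + 1)).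
  rewrite (sqrtrM (weight a t) (ltW r0)) (sqrtrV (ltW r0)).
  rewrite -{2}[lag_norm a k]sqr_sqrtr ?(ltW r0)//.
  have : Num.sqrt (lag_norm a k) != 0 by rewrite gt_eqF// sqrtr_gt0.
  move: (Num.sqrt (lag_norm a k)) (Num.sqrt (weight a t)) => x y x0.
  by field; rewrite x0 gt_eqF.
by rewrite /ell_low ler_pM2r ?invr_gt0 ?mulr_gt0// ler_wsqrtr.
Qed.

Definition lower_const : R := ell_low * 2 `^ (- mu) * 2 `^ (- sigma).

Lemma lower_const_gt0 : 0 < lower_const.
Proof.
by apply: mulr_gt0; rewrite ?powR_gt0//; apply: mulr_gt0 ell_low_gt0 _; rewrite powR_gt0.
Qed.

(** Both distances to z are recorded since the two error notions measure noise differently. The zero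
    datum z is built as a sum with zero coefficients, so that the formula for the norm of a
    difference applies. *)
Lemma lower_witness (X : R) : 1 <= X -> exists f g z : L2w a, exists2 t : R, 0 < t &
  [/\ (W s mu f /\ W s mu g),
      lower_const * X `^ (- sigma) <= wrep f t, wrep g t = - wrep f t,
      (norm2 a ((f : R -> R) \- (z : R -> R)) <= X `^ (- (sigma + 2^-1)) /\
       norm2 a ((g : R -> R) \- (z : R -> R)) <= X `^ (- (sigma + 2^-1))) &
      (ell2_norm (coef z \- coef f)%R <= (X `^ (- (sigma + 2^-1)))%:E)%E /\
      (ell2_norm (coef z \- coef g)%R <= (X `^ (- (sigma + 2^-1)))%:E)%E].
Proof.
move=> X1; have X0 : 0 < X by exact: lt_le_trans X1.
(* This places M between X and 2X: the lower bound makes the block close enough to 0, the upper one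
   keeps its value at t large and gives the factor 2^(-sigma) of [lower_const]. *)
pose M := (Num.truncn X).+1.
have /andP[tX /ltW XM] := truncn_itv (ltW X0); rewrite -/M in XM.
have M2X : M%:R <= 2 * X by rewrite /M -natr1; lra.
have M0 : (0 < M)%N by [].
have M0' : (0 : R) < M%:R by rewrite ltr0n.
pose d := X `^ (- (sigma + 2^-1)).
have d0 : 0 <= d by exact: powR_ge0.
have blockE k : (if (k < 2 * M)%N then block M k else 0) = block M k.
  by rewrite /block; case: (ltnP k (2 * M)%N) => //; rewrite andbF.
have sumsq n : \sum_(k < n) block M k ^+ 2 <= d ^+ 2.
  apply: (@le_trans _ _ (M%:R * block_height M ^+ 2)).
    apply: le_trans (sum_block M n (sqr_ge0 (block_height M))).
    by apply: ler_sum => k _; rewrite /block; case: ifP => //; rewrite expr0n.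
  have -> : M%:R * block_height M ^+ 2 = (Num.sqrt M%:R * block_height M) ^+ 2.
    by rewrite [RHS]exprMn sqr_sqrtr.
  rewrite lerXn2r ?nnegrE ?mulr_ge0 ?sqrtr_ge0 ?block_height_ge0//.
  apply: (@le_trans _ _ (M%:R `^ (- (sigma + 2^-1)))); last first.
    by apply: ler_powRN => //; rewrite addr_ge0 ?(ltW sigma0).
  have -> : M%:R `^ (- (sigma + 2^-1)) = Num.sqrt M%:R * M%:R `^ (- (sigma + 1)) :> R.
    rewrite -powR12_sqrt ?ler0n// -powRD ?(gt_eqF M0') ?implybT//.
    by congr (_ `^ _); field.
  rewrite /block_height mulrCA ler_piMl ?mulr_ge0 ?powR_ge0 ?sqrtr_ge0//.
  by rewrite powRN invf_le1 ?powR_gt0// -[leLHS](powRr0 2) ler_powR ?ler1n// ltW.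
pose f := L2w_sum a0 (2 * M) (block M).
pose g := L2w_sum a0 (2 * M) (fun k => - block M k).
pose z := L2w_sum a0 (2 * M) (fun=> 0).
have cf k : coef f k = block M k by rewrite coef_L2w_sum blockE.
have cg k : coef g k = - block M k.
  by rewrite coef_L2w_sum -[in RHS]blockE; case: ifP; rewrite ?oppr0.
have cz k : coef z k = 0 by rewrite coef_L2w_sum; case: ifP.
have b0 k : 0 <= block M k.
  by rewrite /block; case: ifP => // _; exact: block_height_ge0.
exists f, g, z; exists (6 * M%:R)^-1; first by rewrite invr_gt0 mulr_gt0.
split.
- by split; apply: (W_block M0) => k; rewrite ?cf ?cg ?normrN ger0_norm.
- rewrite wrep_L2w_sum.
  apply: (@le_trans _ _ (\sum_(k < 2 * M) block M k * ell_low)).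
    rewrite -mulr_suml /block sum_block_eq /block_height.
    have -> : M%:R * (2 `^ (- mu) * M%:R `^ (- (sigma + 1))) =
        2 `^ (- mu) * M%:R `^ (- sigma) :> R.
      rewrite mulrCA; congr (_ * _).
      rewrite -{1}[M%:R](@powRr1 R) ?ler0n// -powRD ?(gt_eqF M0') ?implybT//.
      by congr (_ `^ _); ring.
    have h : 2 `^ (- sigma) * X `^ (- sigma) <= M%:R `^ (- sigma).
      by rewrite -powRM ?(ltW X0)//; apply: ler_powRN; rewrite ?(ltW sigma0).
    have e0 : 0 <= ell_low * 2 `^ (- mu).
      by apply: mulr_ge0; [exact: ltW ell_low_gt0|exact: powR_ge0].
    have := ler_wpM2l e0 h; rewrite /lower_const; lra.
  apply: ler_sum => k _; rewrite {1 2}/block; case: ifPn => [Mk|]; last by rewrite !mul0r.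
  by rewrite ler_wpM2l ?block_height_ge0// ell_weight_ge.
- by rewrite !wrep_L2w_sum -sumrN; apply: eq_bigr => k _; rewrite mulNr.
- have sqrt_le (c : R^nat) : (forall k, c k ^+ 2 = block M k ^+ 2) ->
      Num.sqrt (\sum_(k < 2 * M) c k ^+ 2) <= d.
    move=> cE; rewrite -(ger0_norm d0) -sqrtr_sqr ler_wsqrtr//.
    by under eq_bigr do rewrite cE.
  rewrite !norm2_L2w_sum; split.
  + by apply: (sqrt_le (fun k => block M k - 0)) => k; rewrite subr0.
  + by apply: (sqrt_le (fun k => - block M k - 0)) => k; rewrite subr0 sqrrN.
- split; apply/(ell2_norm_leP _ d0) => n; apply: le_trans (sumsq n);
    apply: ler_sum => k _; rewrite /= cz ?cf ?cg sub0r ?opprK ?sqrrN//.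
Qed.

(** The sign of h(t) decides: a value of the recovered function that is not positive misses f, a
    positive one misses g = - f at that point. *)
Lemma errC_ge_witness (f g : L2w a) (h : R -> R) (t y : R) : 0 < t ->
  y <= wrep f t -> wrep g t = - wrep f t ->
  (y%:E <= errC f h)%E \/ (y%:E <= errC g h)%E.
Proof.
move=> t0 yf gf; pose v := h t * Num.sqrt (weight a t).
have mem (b : L2w a) : (`|wrep b t - v|%:E <= errC b h)%E.
  apply: ereal_sup_ubound; exists t => //.
  by rewrite /= in_itv/= andbT.
have [v0|v0] := leP v 0; [left|right].
- apply: le_trans (mem f); rewrite lee_fin (le_trans yf)//.
  by rewrite (le_trans _ (ler_norm _))// lerBrDr gerDl.
- apply: le_trans (mem g); rewrite lee_fin (le_trans yf)// gf -opprD normrN.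
  by rewrite (le_trans _ (ler_norm _))// lerDl ltW.
Qed.

(* At the datum [z] the method cannot distinguish [f] from [g = - f]. *)
Lemma err_func_ge (X : R) (A : L2w a -> R -> R) : 1 <= X ->
  ((lower_const * X `^ (- sigma))%:E <= err_func s mu (X `^ (- (sigma + 2^-1))) A)%E.
Proof.
move=> /lower_witness[f [g [z [t t0 [[Wf Wg] cf gf [nf ng] _]]]]].
have mem (b : L2w a) : W s mu b ->
    norm2 a ((b : R -> R) \- (z : R -> R)) <= X `^ (- (sigma + 2^-1)) ->
    (errC b (A z) <= err_func s mu (X `^ (- (sigma + 2^-1))) A)%E.
  move=> Wb nb; apply: (@le_trans _ _ (ereal_sup [set errC b (A fd) |
    fd in [set fd : L2w a | norm2 a ((b : R -> R) \- (fd : R -> R))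
                            <= X `^ (- (sigma + 2^-1))]])).
    by apply: ereal_sup_ubound; exists z.
  by apply: ereal_sup_ubound; exists b.
have [/le_trans|/le_trans] := errC_ge_witness (A z) t0 cf gf; apply; exact: mem.
Qed.

Lemma err_coef_ge (X : R) (A : L2w a -> R -> R) : 1 <= X ->
  ((lower_const * X `^ (- sigma))%:E <= err_coef s mu (X `^ (- (sigma + 2^-1))) A)%E.
Proof.
move=> /lower_witness[f [g [z [t t0 [[Wf Wg] cf gf _ [nf ng]]]]]].
have mem (b : L2w a) : W s mu b ->
    (ell2_norm (coef z \- coef b)%R <= (X `^ (- (sigma + 2^-1)))%:E)%E ->
    (errC b (A z) <= err_coef s mu (X `^ (- (sigma + 2^-1))) A)%E.
  move=> Wb nb; apply: (@le_trans _ _ (ereal_sup [set errC b (A fd) |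
    fd in [set fd : L2w a | (ell2_norm (coef fd \- coef b)%R
                            <= (X `^ (- (sigma + 2^-1)))%:E)%E]])).
    by apply: ereal_sup_ubound; exists z.
  by apply: ereal_sup_ubound; exists b.
have [/le_trans|/le_trans] := errC_ge_witness (A z) t0 cf gf; apply; exact: mem.
Qed.

End lower_bound.

Lemma asymp_sandwich (R : realType) (c c1 c2 d1 d2 rho : R) (A B : \bar R) : 0 <= rho -> 0 <= c ->
  ((c2 * rho)%:E <= A)%E -> (A <= (c1 * rho)%:E)%E ->
  ((d2 * rho)%:E <= B)%E -> (B <= (d1 * rho)%:E)%E ->
  c1 <= c * d2 -> d1 <= c * c2 -> asymp c A B.
Proof.
move=> r0 c0 A2 A1 B2 B1 h1 h2; have c0' : (0 <= c%:E)%E by rewrite lee_fin.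
split.
- apply: le_trans A1 _; apply: le_trans (lee_wpmul2l c0' B2).
  by rewrite -EFinM lee_fin mulrA ler_wpM2r.
- apply: le_trans B1 _; apply: le_trans (lee_wpmul2l c0' A2).
  by rewrite -EFinM lee_fin mulrA ler_wpM2r.
Qed.

(** Change of parameter from delta to X = [Nopt], which is at least 1 and in which noise and rate
    are plain negative powers. *)
Lemma NoptE (R : realType) (s : \bar R) (mu delta : R) :
  0 < decay s mu -> 0 < delta < 1 ->
  [/\ 1 <= Nopt s mu delta, Nopt s mu delta `^ (- (decay s mu + 2^-1)) = delta &
      Nopt s mu delta `^ (- decay s mu) = rate s mu delta].
Proof.
move=> sigma0 /andP[d0 d1].
have e : mu + sinv s - 2^-1 = decay s mu + 2^-1 by rewrite /decay; field.
have e0 : 0 < decay s mu + 2^-1 by rewrite addr_gt0.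
have en0 : decay s mu + 2^-1 != 0 by rewrite gt_eqF.
rewrite /Nopt /rate e; split.
- rewrite powRN -[leLHS]invr1 lef_pV2 ?posrE ?powR_gt0//.
  rewrite -[leRHS](powRr0 delta) ger_powR ?d0 ?(ltW d1)//.
  by rewrite divr_ge0// ltW.
- rewrite -powRrM mulrNN div1r mulVf// powRr1// ltW//.
- by rewrite -powRrM mulrNN div1r mulrC.
Qed.

(** * Rates of the optimal recovery errors *)

Section recovery_rates.
Context {R : realType}.
Variables (a mu : R) (s : \bar R).
Hypothesis a0 : 0 <= a.
Hypothesis s1 : (1 <= s)%E.
Local Notation sigma := (decay s mu).
Hypothesis sigma0 : 0 < sigma.

Lemma continuous_partial_sum nu M (f : L2w a) : Cpos (partial_sum nu M f).
Proof.
have -> : partial_sum nu M f = horner (ell_sum a M (fun k => nu k * coef f k)).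
  apply/funext => t; rewrite /partial_sum /ell_sum horner_sum.
  by apply: eq_bigr => k _; rewrite hornerZ -horner_ell_poly.
by move=> t _; exact: continuous_horner.
Qed.

Lemma err_func_le (A : L2w a -> R -> R) (d : R) (C : \bar R) :
  (forall f fd : L2w a, W s mu f ->
     norm2 a ((f : R -> R) \- (fd : R -> R)) <= d -> (errC f (A fd) <= C)%E) ->
  (err_func s mu d A <= C)%E.
Proof.
move=> h; apply: ge_ereal_sup => z [f Wf <-{z}].
by apply: ge_ereal_sup => z [fd /= nfd <-{z}]; exact: h.
Qed.

Lemma err_coef_le (A : L2w a -> R -> R) (d : R) (C : \bar R) :
  (forall f fd : L2w a, W s mu f ->
     (ell2_norm (coef fd \- coef f)%R <= d%:E)%E -> (errC f (A fd) <= C)%E) ->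
  (err_coef s mu d A <= C)%E.
Proof.
move=> h; apply: ge_ereal_sup => z [f Wf <-{z}].
by apply: ge_ereal_sup => z [fd /= nfd <-{z}]; exact: h.
Qed.

Lemma norm2_coef_sum (f fd : L2w a) (d : R) M :
  norm2 a ((f : R -> R) \- (fd : R -> R)) <= d ->
  \sum_(k < M) (coef fd k - coef f k) ^+ 2 <= d ^+ 2.
Proof.
move=> h; apply: le_trans (Bessel_coef a0 f fd M) _.
by rewrite lerXn2r ?nnegrE ?sqrtr_ge0// (le_trans _ h)// sqrtr_ge0.
Qed.

(** Truncation as a map on sequences, the form demanded of a recovery operator in [Psi] and
    [PsiN]. *)
Definition sampled_sum (M : nat) (x : R^nat) (t : R) : R :=
  \sum_(k < M) x k * ell a k t.

Lemma sampled_sumE M (f : L2w a) :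
  sampled_sum M (coef f) = partial_sum (fun=> 1) M f.
Proof. by apply/funext => t; apply: eq_bigr => k _; rewrite mul1r. Qed.

Lemma sampled_sum_Cpos M x : Cpos (sampled_sum M x).
Proof.
have -> : sampled_sum M x = horner (ell_sum a M x).
  apply/funext => t; rewrite /sampled_sum /ell_sum horner_sum.
  by apply: eq_bigr => k _; rewrite hornerZ -horner_ell_poly.
by move=> t _; exact: continuous_horner.
Qed.

Definition first_indices (M : nat) : {fset nat} := [fset k in iota 0 M]%fset.

Lemma in_first_indices M k : (k \in first_indices M) = (k < M)%N.
Proof. by rewrite /first_indices in_fset mem_iota. Qed.

Lemma sampled_sum_coef_on M (f : L2w a) :
  sampled_sum M (coef_on (first_indices M) f) = partial_sum (fun=> 1) M f.
Proof.
apply/funext => t; apply: eq_bigr => k _.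
by rewrite /coef_on in_first_indices ltn_ord mul1r.
Qed.

Lemma sampled_sum_PsiN M :
  @PsiN R a M (sampled_sum M \o coef_on (first_indices M)).
Proof.
exists (first_indices M); first by rewrite card_fseq (leq_trans (size_undup _))// size_iota.
by exists (sampled_sum M) => // x _; exact: sampled_sum_Cpos.
Qed.

Lemma errC_partial_sum_le (l u : R) : 0 < l -> l <= u ->
  exists2 c : R, 0 < c & forall (X : R) (M : nat) (f fd : L2w a),
    1 <= X -> (0 < M)%N -> l * X <= M%:R <= u * X -> W s mu f ->
    \sum_(k < M) (coef fd k - coef f k) ^+ 2 <= (X `^ (- (sigma + 2^-1))) ^+ 2 ->
    (errC f (partial_sum (fun=> 1%R) M fd) <= (c * X `^ (- sigma))%:E)%E.
Proof.
(* Multipliers equal to 1 satisfy the damping condition with constant 0, so any theta above sigma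
   will do. *)
move=> l0 lu; have st : sigma < sigma + 1 by rewrite ltrDl.
have [c c0 h] := errC_le_rate a0 s1 sigma0 st (lexx 0) l0 lu.
exists c => // X M f fd X1 M0 lMu Wf hd.
apply: (h X M M) => //; first by rewrite leq_pmull.
by move=> k _; rewrite subrr normr0 mul0r.
Qed.

Lemma E_opt_le (l u : R) : 0 < l -> l <= u ->
  exists2 c : R, 0 < c & forall (X : R) (M : nat), 1 <= X -> (0 < M)%N ->
    l * X <= M%:R <= u * X ->
    [/\ (E_opt a s mu (X `^ (- (sigma + 2^-1))) <= (c * X `^ (- sigma))%:E)%E,
        (E_Psi a s mu (X `^ (- (sigma + 2^-1))) <= (c * X `^ (- sigma))%:E)%E &
        (R_opt a s mu M (X `^ (- (sigma + 2^-1))) <= (c * X `^ (- sigma))%:E)%E].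
Proof.
move=> l0 lu; have [c c0 h] := errC_partial_sum_le l0 lu.
exists c => // X M X1 M0 lMu; have d0 := powR_ge0 X (- (sigma + 2^-1)).
split.
- apply: (@le_trans _ _ (err_func s mu (X `^ (- (sigma + 2^-1)))
    (partial_sum (fun=> 1) M))).
    apply: ereal_inf_lbound; exists (partial_sum (fun=> 1) M) => //.
    by move=> f _; exact: continuous_partial_sum.
  apply: err_func_le => f fd Wf nfd; apply: h => //.
  exact: norm2_coef_sum.
- apply: (@le_trans _ _ (err_coef s mu (X `^ (- (sigma + 2^-1)))
    (sampled_sum M \o @coef R a))).
    apply: ereal_inf_lbound; exists (sampled_sum M \o @coef R a) => //.
    by exists (sampled_sum M) => // x _; exact: sampled_sum_Cpos.
  apply: err_coef_le => f fd Wf nfd; rewrite /= sampled_sumE; apply: h => //.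
  exact: ((ell2_norm_leP (coef fd \- coef f)%R d0).1 nfd M).
- apply: (@le_trans _ _ (err_coef s mu (X `^ (- (sigma + 2^-1)))
    (sampled_sum M \o coef_on (first_indices M)))).
    apply: ereal_inf_lbound; exists (sampled_sum M \o coef_on (first_indices M)) => //.
    exact: sampled_sum_PsiN.
  apply: err_coef_le => f fd Wf nfd; rewrite /= sampled_sum_coef_on; apply: h => //.
  exact: ((ell2_norm_leP (coef fd \- coef f)%R d0).1 nfd M).
Qed.

Hypothesis mu0 : 0 < mu.

Lemma E_opt_ge (X : R) : 1 <= X ->
  ((lower_const a mu s * X `^ (- sigma))%:E <= E_opt a s mu (X `^ (- (sigma + 2^-1))))%E.
Proof. by move=> X1; apply: le_ereal_inf_tmp => z [A _ <-]; exact: err_func_ge. Qed.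

Lemma E_Psi_ge (X : R) : 1 <= X ->
  ((lower_const a mu s * X `^ (- sigma))%:E <= E_Psi a s mu (X `^ (- (sigma + 2^-1))))%E.
Proof. by move=> X1; apply: le_ereal_inf_tmp => z [A _ <-]; exact: err_coef_ge. Qed.

Lemma R_opt_ge (X : R) M : 1 <= X ->
  ((lower_const a mu s * X `^ (- sigma))%:E <= R_opt a s mu M (X `^ (- (sigma + 2^-1))))%E.
Proof. by move=> X1; apply: le_ereal_inf_tmp => z [A _ <-]; exact: err_coef_ge. Qed.

End recovery_rates.

Theorem theorem4p15 (R : realType) (a : R) (s : \bar R) (mu : R) :
  0 <= a -> (1 <= s)%E -> 1 - sinv s < mu -> 0 < mu ->
  [/\ exists2 c : R, 0 < c &
        forall delta : R, 0 < delta < 1 ->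
          asymp c (E_opt a s mu delta) (E_Psi a s mu delta) /\
          asymp c (E_Psi a s mu delta) (rate s mu delta)%:E,
      forall l u : R, 0 < l -> l <= u ->
        exists2 c : R, 0 < c &
          forall (delta : R) (N : nat), 0 < delta < 1 -> (1 <= N)%N ->
            l * Nopt s mu delta <= N%:R <= u * Nopt s mu delta ->
            asymp c (R_opt a s mu N delta) (rate s mu delta)%:E /\
            asymp c (rate s mu delta)%:E (N%:R `^ (- mu - sinv s + 1))%:E
    & forall theta Cnu l u : R, mu + sinv s - 1 < theta -> 0 < theta ->
        0 < Cnu -> 0 < l -> l <= u ->
        exists2 c : R, 0 < c &
          forall nu : nat -> nat -> R, in_S theta Cnu nu ->
          forall (delta : R) (N : nat), 0 < delta < 1 -> (1 <= N)%N ->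
            l * Nopt s mu delta <= N%:R <= u * Nopt s mu delta ->
            (err_func s mu delta (@summation R a nu N)
               <= (c * rate s mu delta)%:E)%E].
Proof.
move=> a0 s1 smu mu0.
have sigma0 : 0 < decay s mu by rewrite /decay; lra.
pose c2 := lower_const a mu s.
have c20 : 0 < c2 by exact: lower_const_gt0.
(* One constant dominates each ratio between the upper constant c1, the lower constant c2 and 1 that
   the comparisons require. *)
have const_le (c1 : R) : 0 < c1 ->
    [/\ 0 < c1 / c2 + c1 + c2^-1, c1 <= (c1 / c2 + c1 + c2^-1) * c2,
        c1 <= (c1 / c2 + c1 + c2^-1) * 1 & 1 <= (c1 / c2 + c1 + c2^-1) * c2].
  move=> c10; have h1 : 0 < c1 / c2 by rewrite divr_gt0.
  have h2 : 0 < c2^-1 by rewrite invr_gt0.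
  have h3 : 0 < c1 * c2 by rewrite mulr_gt0.
  rewrite mulr1 !mulrDl divfK ?mulVf ?gt_eqF//.
  by split; lra.
split.
- have [c1 c10 up] := E_opt_le a0 s1 sigma0 (@ltr01 R) (ler1n R 2).
  have [c0 k1 k2 k3] := const_le _ c10.
  exists (c1 / c2 + c1 + c2^-1) => // delta d01.
  have [X1 Xd Xr] := NoptE sigma0 d01; set X := Nopt s mu delta in X1 Xd Xr *.
  have X0 : 0 <= X by rewrite (le_trans ler01).
  have /andP[tX /ltW XM] := truncn_itv X0.
  have XM2 : 1 * X <= (Num.truncn X).+1%:R <= 2%:R * X.
    by rewrite mul1r XM/= -natr1; lra.
  have [] := up X _ X1 _ XM2; first by [].
  rewrite Xd Xr => Eup Pup _.
  have Elo := E_opt_ge a0 s1 sigma0 mu0 X1; rewrite Xd Xr in Elo.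
  have Plo := E_Psi_ge a0 s1 sigma0 mu0 X1; rewrite Xd Xr in Plo.
  have r0 : 0 <= rate s mu delta by rewrite powR_ge0.
  split; first exact: (asymp_sandwich r0 (ltW c0) Elo Eup Plo Pup).
  by apply: (asymp_sandwich r0 (ltW c0) Plo Pup (d1 := 1) (d2 := 1)); rewrite ?mul1r.
- move=> l u l0 lu; have u0 : 0 < u by exact: lt_le_trans lu.
  have [c1 c10 up] := E_opt_le a0 s1 sigma0 l0 lu.
  have [c0 k1 k2 k3] := const_le _ c10.
  set c3 := c1 / c2 + c1 + c2^-1 in c0 k1 k2 k3 *.
  have us : 0 < u `^ decay s mu by rewrite powR_gt0.
  have ls : 0 < l `^ (- decay s mu) by rewrite powR_gt0.
  exists (c3 + u `^ decay s mu + l `^ (- decay s mu)); first by lra.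
  move=> delta N d01 N1 lNu.
  have [X1 Xd Xr] := NoptE sigma0 d01; set X := Nopt s mu delta in X1 Xd Xr lNu *.
  have X0 : 0 < X by rewrite (lt_le_trans ltr01).
  have [_ _] := up X N X1 N1 lNu; rewrite Xd Xr => Rup.
  have Rlo := R_opt_ge a0 s1 sigma0 mu0 N X1; rewrite Xd Xr in Rlo.
  have r0 : 0 <= rate s mu delta by rewrite powR_ge0.
  set c4 := c3 + _ + _; have c40 : 0 <= c4 := ltW (addr_gt0 (addr_gt0 c0 us) ls).
  have c34 : c3 <= c4 by rewrite /c4; lra.
  split.
    apply: (asymp_sandwich r0 c40 Rlo Rup (d1 := 1) (d2 := 1)); rewrite ?mul1r//.
      by rewrite (le_trans k2)// ler_wpM2r.
    by rewrite (le_trans k3)// ler_wpM2r// ltW.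
  have -> : - mu - sinv s + 1 = - decay s mu by rewrite /decay; ring.
  have /andP[lN Nu] := lNu.
  have N0 : (0 : R) < N%:R by rewrite ltr0n.
  (* Both quantities are compared with X^(-sigma): N lies between l X and u X, and the negative
     power exchanges the two bounds. *)
  apply: (@asymp_sandwich R c4 1 1 (l `^ (- decay s mu)) (u `^ (- decay s mu)) _ _ _ r0 c40).
  + by rewrite mul1r.
  + by rewrite mul1r.
  + by rewrite lee_fin -Xr -powRM ?(ltW u0) ?(ltW X0)//; exact: ler_powRN (ltW sigma0) _ _.
  + rewrite lee_fin -Xr -powRM ?(ltW l0) ?(ltW X0)//; apply: (ler_powRN (ltW sigma0)) => //.
    exact: mulr_gt0.
  + rewrite powRN ler_pdivlMr// mul1r /c4.
    have := ltW c0; have := ltW ls; lra.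
  + by rewrite mulr1 /c4; have := ltW c0; have := ltW us; lra.
- move=> theta Cnu l u st t0 Cnu0 l0 lu.
  have u0 : 0 < u by exact: lt_le_trans lu.
  (* The method uses N + 1 terms, and N + 1 <= 2N <= 2u X, so the upper end of the range is
     doubled. *)
  have l2u : l <= 2 * u by lra.
  have [c c0 h] := errC_le_rate a0 s1 sigma0 st (ltW Cnu0) l0 l2u.
  exists c => // nu nuS delta N d01 N1 /andP[lN Nu].
  have [X1 Xd Xr] := NoptE sigma0 d01; set X := Nopt s mu delta in X1 Xd Xr lN Nu *.
  have X0 : 0 < X by rewrite (lt_le_trans ltr01).
  have N1' : (1 : R) <= N%:R by rewrite ler1n.
  have uX0 : 0 < u * X by rewrite mulr_gt0.
  rewrite -[in leRHS]Xr; apply: err_func_le => f fd Wf nfd.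
  apply: (h X N N.+1 (nu N) f fd) => //.
  + by rewrite mul2n -addnn -add1n leq_add2r.
  + by rewrite lN/=; lra.
  + by rewrite -natr1; apply/andP; split; lra.
  + by move=> k; rewrite ltnS => kN; exact: nuS.
  + by rewrite Xd; exact: norm2_coef_sum.
Qed.
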